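(* Let $b = 1+\sqrt{2}$ and $\lambda_n = \log_b n + \log_b\log_b n$. Let $(\Omega_n)$ be a sequence of real numbers with $\Omega_n \to \infty$. For $n \ge 3$, let $\Delta_n$ denote the maximum vertex degree in a uniformly random dissection of a convex $n$-gon. Then, as $n \to \infty$, $$\mathbb{P}(|\Delta_n - \lambda_n| \ge \Omega_n) = O\big((\log n)^{-1} + b^{-\Omega_n}\big).$$
   Context: For $n\ge 3$, let $\mathcal{P}_n$ be the convex $n$-gon in the plane whose vertices are the $n$-th roots of unity. A dissection of $\mathcal{P}_n$ is a subset of the plane that is the union of the sides of $\mathcal{P}_n$ and a collection (possibly empty) of diagonals of $\mathcal{P}_n$ that may intersect only at their endpoints. There are finitely many dissections of $\mathcal{P}_n$; a random dissection is one chosen uniformly among all of them. The degree of a vertex of a dissection is the total number of diagonals and sides of $\mathcal{P}_n$ that lie in the dissection and contain that vertex (so the two sides at the vertex are counted). The maximum vertex degree is the maximum of the degrees over all $n$ vertices. *)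

(* Defs.v *)
From mathcomp Require Import all_boot all_order all_algebra finmap.
From mathcomp Require Import all_classical all_reals all_analysis.

Set Implicit Arguments.
Unset Strict Implicit.
Unset Printing Implicit Defensive.

Import Order.TTheory GRing.Theory Num.Theory numFieldNormedType.Exports.

Local Open Scope classical_set_scope.
Local Open Scope ring_scope.

Section Dissections.
Variable R : realType.

Definition plane : Type := (R * R)%type.

Definition segment (a b : plane) : set plane :=
  [set z | exists2 t : R, 0 <= t <= 1 &
     z = ((1 - t) * a.1 + t * b.1, (1 - t) * a.2 + t * b.2)].

Variable n : nat.

(* The n-th root of unity exp(2 i pi k / n), C being identified with R * R. *)
Definition vertex (k : 'I_n) : plane :=
  (cos (2 * pi * k%:R / n%:R), sin (2 * pi * k%:R / n%:R)).

Definition chord (p : 'I_n * 'I_n) : set plane :=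
  segment (vertex p.1) (vertex p.2).

Definition endpoints (p : 'I_n * 'I_n) : set plane :=
  [set vertex p.1; vertex p.2].

(* An unordered pair of distinct vertices is encoded by (i, j) with i < j,
   so that every side and every diagonal has exactly one code; [ordS] is the
   cyclic successor. *)
Definition is_side (p : 'I_n * 'I_n) : bool :=
  (p.1 < p.2)%N && ((p.2 == ordS p.1) || (p.1 == ordS p.2)).

Definition is_diagonal (p : 'I_n * 'I_n) : bool :=
  (p.1 < p.2)%N && ~~ is_side p.

Definition dissections : set (set plane) :=
  [set S | exists D : {set 'I_n * 'I_n},
     [/\ forall p, p \in D -> is_diagonal p,
         forall p q, p \in D -> q \in D -> p != q ->
           chord p `&` chord q `<=` endpoints p `&` endpoints q
       & S = (\bigcup_(p in [set p | is_side p]) chord p) `|`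
             (\bigcup_(p in [set p | p \in D]) chord p)]].

Lemma finite_dissections : finite_set dissections.
Proof.
pose f (D : {set 'I_n * 'I_n}) := (\bigcup_(p in [set p | is_side p]) chord p) `|`
  (\bigcup_(p in [set p | p \in D]) chord p).
apply: (@sub_finite_set _ _ (range f)); first by move=> S [D [_ _ ->]]; exists D.
exact/finite_image/finite_finset.
Qed.

Definition degree (S : set plane) (k : 'I_n) : nat :=
  #|[set p : 'I_n * 'I_n | (is_side p || is_diagonal p)
       && `[< chord p `<=` S >] && `[< chord p (vertex k) >]]%SET|.

Definition max_degree (S : set plane) : nat := \max_(k < n) degree S k.

(* Probability, for a uniformly random dissection, of belonging to E; as
   [dissections] is finite, [fset_set] is here its genuine finite version. *)
Definition dissection_prob (E : set (set plane)) : R :=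
  #|` fset_set (dissections `&` E)|%:R / #|` fset_set dissections|%:R.

End Dissections.

Definition log_base (R : realType) (b x : R) : R := ln x / ln b.

(* Main.v *)
Require Import Defs.
From HB Require Import structures.
From mathcomp Require Import all_boot all_order all_algebra finmap.
From mathcomp Require Import all_classical all_reals all_analysis.
From mathcomp Require Import zify ring lra.
Import Order.TTheory GRing.Theory Num.Theory numFieldNormedType.Exports.

Set Implicit Arguments.
Unset Strict Implicit.
Unset Printing Implicit Defensive.

(** Cut the boundary of the polygon at vertex 0 and put N = n - 1. A dissection of the n-gon
    becomes a noncrossing set of arcs of length at least two on the points 0, ..., N, without
    the arc from 0 to N. Allowing that arc doubles the number of configurations, and their
    generating function then satisfies G = z (1 + G) / (1 - G), that is G = z + z G + G^2. So a
    configuration is coded by a [tree] with nodes [Leaf], [Unary] and [Bin] ([chords_inj],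
    [chords_surj]). Reading the tree in prefix order, and grouping every run of [Bin] nodes with
    the node that ends it, yields a word of N letters (o, e), with o a natural number and e a
    boolean, whose arities o + e add up to N - 1 ([code]). At the singularity of G the letter
    (o, e) gets the weight b^-(o + e + 1), and these weights form a probability: this is where
    b = 1 + sqrt 2 comes from.

    The decoding opens fans alternately at the right end and at the left end of an edge, so that
    both fans at some of the vertices are described by consecutive letters: after a letter
    (o, false), the letters (i, true), (j, e) produce a vertex with at least i + j diagonals
    ([fan_seen_incident]). As m = i + j has m + 1 decompositions, this pattern occurs at a given
    position with probability of order m b^-m, and m b^-m is of order 1 / n exactly when m is at
    bounded distance from log_b n + log_b log_b n.

    Lower tail. Because the pattern is local, it can be searched for in disjoint triples of
    letters. The N rotations of the codes of trees are pairwise distinct ([rot_code_inj]), and one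
    of the halves of a rotated code is a factor of the code. So N times the number of trees
    without the pattern is at most the number of words with sum N - 1 one half of which avoids
    the pattern ([avoiding_trees_bound]). The other half can be completed in at most a Delannoy
    number of ways, of order b^(k + y) / sqrt k for k letters with sum y ([delannoy_le]), so up to
    a constant the first half behaves like independent letters, in which about n / 6 disjoint
    triples avoid the pattern. On the other hand there are at least c b^(2 N) N^(-3/2) trees
    ([size_trees_ge]). Hence all degrees are below m with probability O(b^m / (n m))
    ([small_degrees_le]).

    Upper tail. All vertices have the same degree distribution. Vertex 0 has at least k diagonals
    exactly when the code starts with k nodes [Bin], that is, when the tree comes from a forest
    of k + 1 trees; there are O(k b^(2 N - k) N^(-3/2)) such forests ([size_forests_le]). The
    union bound gives O(n k b^-k) ([large_degree_le]).

    For m and k at distance w from log_b n + log_b log_b n, both bounds are O(b^-w), provided that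
    w is at most log_b log_b n; for larger deviations this value of w already gives O(1 / log n).

    The binomial estimates behind both counts come from the identity expressing a Delannoy number
    as b^(p + q) times the probability that two independent binomial variables with parameter
    sqrt 2 / b are equal ([delannoyE]). The geometric side is that the vertices are in strictly
    convex position ([orient_vertex_gt0]): chords cross exactly when their endpoints interleave,
    and a dissection determines its diagonals ([card_dissections]). *)

(** * Trees and noncrossing arcs *)

(** The three constructors are the three summands of G = z + z G + G^2. *)
Inductive tree := Leaf | Unary of tree | Bin of tree & tree.

Fixpoint tree_encode (t : tree) : GenTree.tree unit :=
  match t with
  | Leaf => GenTree.Node 0 [::]
  | Unary t => GenTree.Node 1 [:: tree_encode t]
  | Bin s t => GenTree.Node 2 [:: tree_encode s; tree_encode t]
  end.

Fixpoint tree_decode (g : GenTree.tree unit) : option tree :=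
  match g with
  | GenTree.Node 0 [::] => Some Leaf
  | GenTree.Node 1 [:: t] => omap Unary (tree_decode t)
  | GenTree.Node 2 [:: s; t] =>
      if (tree_decode s, tree_decode t) is (Some s', Some t') then Some (Bin s' t')
      else None
  | _ => None
  end.

Lemma tree_encodeK : pcancel tree_encode tree_decode.
Proof. by elim=> [|t /= ->|s /= -> t /= ->]. Qed.

HB.instance Definition _ := Countable.copy tree (pcan_type tree_encodeK).

Fixpoint weight (t : tree) : nat :=
  match t with
  | Leaf => 1
  | Unary t => (weight t).+1
  | Bin s t => weight s + weight t
  end.

Lemma weight_gt0 t : 0 < weight t.
Proof. by elim: t => //= s hs t _; rewrite addn_gt0 hs. Qed.

(** End of the first edge of the configuration decoded by [chords None x t]: the farthest
    neighbour of [x], at which the fan of that edge has its apex. *)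
Fixpoint tip (x : nat) (t : tree) : nat :=
  if t is Bin s t then tip (x + weight s) t else x.+1.

(** With [f = None], [t] is decoded on the points [x], ..., [x + weight t]. The leading [Bin]
    nodes form a fan with apex [tip x t], the right end of the first edge; the first of them
    contributes the arc from [x] itself. With [f = Some a], [t] is decoded on the apex [a]
    followed by the points [x], ..., [x + weight t - 1], and the leading [Bin] nodes form a fan
    with apex [a], the left end of the first edge. A [Unary] node ends the current fan. After a
    right-hand fan the same apex goes on with a left-hand fan: this is why both fans of that
    vertex are described by adjacent pieces of the tree. *)
Fixpoint chords (f : option nat) (x : nat) (t : tree) : seq (nat * nat) :=
  match t, f with
  | Leaf, _ => [::]
  | Unary t, None => chords (Some x.+1) x.+2 t
  | Unary t, Some _ => chords None x t
  | Bin s t, None =>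
      (x, tip (x + weight s) t) :: chords None x s ++ chords None (x + weight s) t
  | Bin s t, Some a =>
      (a, x + weight s) :: chords None x s ++ chords (Some a) (x + weight s) t
  end.

Definition cross (p q : nat * nat) : bool := (p.1 < q.1) && (q.1 < p.2 < q.2).

Definition noncrossing (D : {pred nat * nat}) : Prop :=
  {in D &, forall p q, ~~ cross p q}.

Definition in_range (f : option nat) (x l : nat) (p : nat * nat) : bool :=
  if f is Some a then
    ((p.1 == a) && (x < p.2 < x + l)) || [&& x <= p.1, p.1.+1 < p.2 & p.2 < x + l]
  else [&& x <= p.1, p.1.+1 < p.2 & p.2 <= x + l].

Definition apex_ok (f : option nat) (x : nat) : bool :=
  if f is Some a then a < x else true.

Lemma tip_gt x t : x < tip x t.
Proof.
elim: t x => //= s _ t IH x; apply: leq_ltn_trans (IH _); exact: leq_addr.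
Qed.

Lemma tip_le x t : tip x t <= x + weight t.
Proof.
elim: t x => [|t IH|s _ t IH] x /=; rewrite ?addn1 ?addnS ?ltnS ?leq_addr //.
by rewrite addnA.
Qed.

Lemma tip_gt1 x s t : x.+1 < tip (x + weight s) t.
Proof. by have := tip_gt (x + weight s) t; have := weight_gt0 s; lia. Qed.

Lemma chords_range t f x p : apex_ok f x -> p \in chords f x t ->
  in_range f x (weight t) p.
Proof.
elim: t f x p => [|t IH|s IHs t IHt] [a|] x [i j] //= ax.
- by move/(IH None x _ isT) => /=; lia.
- by move/(IH (Some _) _ _ (ltnSn _)) => /=; lia.
- have ws := weight_gt0 s; have wt := weight_gt0 t.
  rewrite inE mem_cat xpair_eqE => /or3P[/andP[/eqP-> /eqP->]|/(IHs None _ _ isT)|] /=.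
  + by lia.
  + by lia.
  + by move/(IHt (Some a)) => /=; lia.
- have ws := weight_gt0 s; have wt := weight_gt0 t.
  have t1 := tip_gt1 x s t; have t2 := tip_le (x + weight s) t.
  rewrite inE mem_cat xpair_eqE => /or3P[/andP[/eqP-> /eqP->]|/(IHs None _ _ isT)|] /=.
  + by lia.
  + by lia.
  + by move/(IHt None _ _ isT) => /=; lia.
Qed.

(** The end of the first edge stays visible from above, so the arc that a [Bin] node adds
    from [x] to that point crosses nothing. *)
Lemma tip_unjumped t x p : p \in chords None x t -> ~~ (p.1 < tip x t < p.2).
Proof.
elim: t x p => [|t IH|s IHs t IHt] x [i j] //=.
- by move/(@chords_range t (Some x.+1) x.+2 _ (ltnSn _)) => /=; lia.
- rewrite inE mem_cat xpair_eqE => /or3P[/andP[/eqP-> /eqP->]|/(@chords_range s None x _ isT)|]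
  /=.
  + by rewrite ltnn andbF.
  + by have := tip_gt (x + weight s) t; lia.
  + by move/IHt => /=; lia.
Qed.

Lemma tip_chord t x : tip x t = x.+1 \/ (x, tip x t) \in chords None x t.
Proof. by case: t => [|t|s t] /=; [left|left|right; rewrite mem_head]. Qed.

Lemma chords_noncrossing t f x : apex_ok f x -> noncrossing [in chords f x t].
Proof.
elim: t f x => [|t IH|s IHs t IHt] f x ax //=.
- by case: f ax => [a|] ax; [apply: (IH None x isT)|apply: (IH (Some _)) => /=].
- have ws := weight_gt0 s; have wt := weight_gt0 t.
  have Rs := @chords_range s None x _ isT.
  have Ns := IHs None x isT.
  case: f ax => [a|] /= ax.
  + have Rt := @chords_range t (Some a) (x + weight s) _ (ltn_addr _ ax).
    have Nt := IHt (Some a) (x + weight s) (ltn_addr _ ax).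
    move=> [i j] [k l]; rewrite !inE !mem_cat !xpair_eqE.
    move=> /or3P[/andP[/eqP-> /eqP->]|/[dup] m1 /Rs r1|/[dup] m1 /Rt r1];
    move=> /or3P[/andP[/eqP-> /eqP->]|/[dup] m2 /Rs r2|/[dup] m2 /Rt r2];
      try (by move: (Ns _ _ m1 m2)); try (by move: (Nt _ _ m1 m2));
      rewrite /cross; move=> /=; try move: r1 => /=; try move: r2 => /=; lia.
  + have Rt := @chords_range t None (x + weight s) _ isT.
    have Nt := IHt None (x + weight s) isT.
    have t1 := tip_gt (x + weight s) t; have t2 := tip_le (x + weight s) t.
    have J := @tip_unjumped t (x + weight s).
    move=> [i j] [k l]; rewrite !inE !mem_cat !xpair_eqE.
    move=> /or3P[/andP[/eqP-> /eqP->]|/[dup] m1 /Rs r1|/[dup] /[dup] m1 /Rt r1 /J j1];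
    move=> /or3P[/andP[/eqP-> /eqP->]|/[dup] m2 /Rs r2|/[dup] /[dup] m2 /Rt r2 /J j2];
      try (by move: (Ns _ _ m1 m2)); try (by move: (Nt _ _ m1 m2));
      rewrite /cross; move=> /=; try move: r1 => /=; try move: r2 => /=;
      try move: j1 => /=; try move: j2 => /=; lia.
Qed.

Lemma chords_uniq t f x : apex_ok f x -> uniq (chords f x t).
Proof.
elim: t f x => [|t IH|s IHs t IHt] f x ax //=.
- by case: f ax => [a|] ax; [apply: (IH None x isT)|apply: (IH (Some _)) => /=].
- have ws := weight_gt0 s; have wt := weight_gt0 t.
  have Rs := @chords_range s None x _ isT.
  case: f ax => [a|] ax.
  + have ax' : apex_ok (Some a) (x + weight s) := ltn_addr _ ax.
    have Rt := @chords_range t (Some a) (x + weight s) _ ax'.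
    rewrite /= cat_uniq (IHs None x isT) (IHt (Some a) _ ax') mem_cat andbT.
    apply/andP; split; first by apply/negP => /orP[/Rs|/Rt] /=; move: ax => /=; lia.
    apply/hasPn => -[i j] /Rt /= h; apply/negP => /Rs /=; move: ax h => /=; lia.
  + have Rt := @chords_range t None (x + weight s) _ isT.
    have t1 := tip_gt (x + weight s) t; have t2 := tip_le (x + weight s) t.
    rewrite /= cat_uniq (IHs None x isT) (IHt None _ isT) mem_cat andbT.
    apply/andP; split; first by apply/negP => /orP[/Rs|/Rt] /=; lia.
    apply/hasPn => -[i j] /Rt /= h; apply/negP => /Rs /=; move: h; lia.
Qed.

(** The subtrees of a [Bin] node are recovered by restricting the arcs to either side of
    [x + weight s]; see also the next two lemmas. Injectivity thus reduces to reading [weight s]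
    off the arcs. *)
Lemma mem_chords_left f x s t p : apex_ok f x ->
  p \in chords None x s = (p \in chords f x (Bin s t)) && (x <= p.1) && (p.2 <= x + weight s).
Proof.
move=> ax; have ws := weight_gt0 s; have wt := weight_gt0 t.
have Rs := @chords_range s None x p isT.
case: p Rs => i j; case: f ax => [a|] /= ax Rs.
- have Rt := @chords_range t (Some a) (x + weight s) (i, j) (ltn_addr _ ax).
  rewrite inE mem_cat xpair_eqE.
  case: (boolP (_ \in _)) Rs => [_ /(_ isT)|_ _] /=; first by rewrite orbT => /and3P[-> _ ->].
  by case: (boolP (_ \in _)) Rt => [_ /(_ isT)|_ _] /=; lia.
- have Rt := @chords_range t None (x + weight s) (i, j) isT.
  have t1 := tip_gt (x + weight s) t.
  rewrite inE mem_cat xpair_eqE.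
  case: (boolP (_ \in _)) Rs => [_ /(_ isT)|_ _] /=; first by rewrite orbT => /and3P[-> _ ->].
  by case: (boolP (_ \in _)) Rt => [_ /(_ isT)|_ _] /=; lia.
Qed.

Lemma mem_chords_closing_right x s t p :
  p \in chords None (x + weight s) t = (p \in chords None x (Bin s t)) && (x + weight s <= p.1).
Proof.
have ws := weight_gt0 s; have wt := weight_gt0 t.
have Rs := @chords_range s None x p isT.
have Rt := @chords_range t None (x + weight s) p isT.
case: p Rs Rt => i j /= Rs Rt; rewrite inE mem_cat xpair_eqE.
case: (boolP ((i, j) \in chords _ _ t)) Rt => [_ /(_ isT)|_ _] /=.
  by rewrite !orbT => /andP[-> _].
by case: (boolP (_ \in _)) Rs => [_ /(_ isT)|_ _] /=; lia.
Qed.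

Lemma mem_chords_opening_right a x s t p : a < x ->
  p \in chords (Some a) (x + weight s) t =
    (p \in chords (Some a) x (Bin s t)) &&
    ((x + weight s <= p.1) || (p.1 == a) && (x + weight s < p.2)).
Proof.
move=> ax; have ws := weight_gt0 s; have wt := weight_gt0 t.
have Rs := @chords_range s None x p isT.
have Rt := @chords_range t (Some a) (x + weight s) p (ltn_addr _ ax).
case: p Rs Rt => i j /= Rs Rt; rewrite inE mem_cat xpair_eqE.
case: (boolP ((i, j) \in chords _ _ t)) Rt => [_ /(_ isT)|_ _] /=.
  by rewrite !orbT; lia.
by case: (boolP (_ \in _)) Rs => [_ /(_ isT)|_ _] /=; lia.
Qed.

Lemma weight_eq1 t : weight t = 1 -> t = Leaf.
Proof.
case: t => //= [t|s t]; have := weight_gt0 t; first lia.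
by have := weight_gt0 s; lia.
Qed.

(** The arcs determine the cut point [x + weight s] of a [Bin] node. In a right-hand fan it is
    the first point after [x] joined to the apex by an arc or by a side; in a left-hand fan it is
    the nearest point joined to the apex by an arc. *)
Lemma chords_inj t t' f x : apex_ok f x -> weight t = weight t' ->
  chords f x t =i chords f x t' -> t = t'.
Proof.
have noapex u y p : p \in chords None y u -> y <= p.1 by move/(@chords_range u None y p isT) =>
  /= /and3P[].
elim: t t' f x => [|t IH|s IHs t IHt] t' f x ax.
- by move/esym/weight_eq1.
- case: t' => [|t'|s' t'].
  + by move/weight_eq1.
  + move=> /= [w]; case: f ax => [a|] ax h; congr Unary; first exact: (IH _ None x isT w h).
    exact: (IH _ (Some x.+1) x.+2 (ltnSn _) w h).
  + move=> _; case: f ax => [a|] /= ax.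
      by move/(_ (a, x + weight s')); rewrite mem_head => /noapex /=; lia.
    move/(_ (x, tip (x + weight s') t')); rewrite mem_head.
    by move/(@chords_range t (Some x.+1) x.+2 _ (ltnSn _)) => /=; lia.
- case: t' => [|t'|s' t'].
  + by move/weight_eq1.
  + move=> _; case: f ax => [a|] /= ax.
      by move/(_ (a, x + weight s)); rewrite mem_head => /esym/noapex /=; lia.
    move/(_ (x, tip (x + weight s) t)); rewrite mem_head.
    by move/esym/(@chords_range t' (Some x.+1) x.+2 _ (ltnSn _)) => /=; lia.
  + move=> w h.
    have ws : weight s = weight s'.
      case: f ax h => [a|] /= ax h.
        have Lt := @chords_range t (Some a) (x + weight s) _ (ltn_addr _ ax).
        have Lt' := @chords_range t' (Some a) (x + weight s') _ (ltn_addr _ ax).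
        apply/eqP; rewrite eqn_leq; apply/andP; split.
          have := h (a, x + weight s'); rewrite mem_head !inE mem_cat xpair_eqE.
          by move/or3P => [|/noapex|/Lt] /=; lia.
        have := esym (h (a, x + weight s)); rewrite mem_head !inE mem_cat xpair_eqE.
        by move/or3P => [|/noapex|/Lt'] /=; lia.
      have tE : tip x (Bin s t) = tip x (Bin s' t').
        have [m1|m1] := tip_chord (Bin s t) x; first by have := tip_gt1 x s t;
          rewrite /= in m1 *; lia.
        have [m2|m2] := tip_chord (Bin s' t') x; first by have := tip_gt1 x s' t';
          rewrite /= in m2 *; lia.
        have := tip_gt x (Bin s t); have := tip_gt x (Bin s' t') => /= g1 g2.
        have j1 := @tip_unjumped (Bin s' t') x _ (etrans (esym (h _)) m1).
        have j2 := @tip_unjumped (Bin s t) x _ (etrans (h _) m2).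
        by move: j1 j2 => /=; lia.
      have key u v u' v' : tip x (Bin u v) = tip x (Bin u' v') ->
          {subset chords None x (Bin u v) <= chords None x (Bin u' v')} ->
          weight u' <= weight u.
        move=> te sub; rewrite leqNgt; apply/negP => lt.
        have := weight_gt0 u; have := tip_gt (x + weight u') v'; rewrite /= in te.
        have [eq1|m] := tip_chord v (x + weight u); first by lia.
        have /sub /= : (x + weight u, tip (x + weight u) v) \in chords None x (Bin u v).
          by rewrite /= inE mem_cat m !orbT.
        rewrite inE mem_cat xpair_eqE => /or3P[|/(@chords_range u' None x _ isT)|/noapex] /=; lia.
      apply/eqP; rewrite eqn_leq; apply/andP; split.
        by apply: (key s' t' s t (esym tE)) => p; rewrite h.
      by apply: (key s t s' t' tE) => p; rewrite h.
    have -> : s = s'.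
      apply: (IHs _ None x isT ws) => p.
      by rewrite (mem_chords_left s t p ax) (mem_chords_left s' t' p ax) h ws.
    congr Bin; case: f ax h => [a|] ax h.
    * apply: (IHt _ (Some a) (x + weight s)); [exact: ltn_addr|by move: w => /=; lia|].
      move=> p; rewrite (mem_chords_opening_right s t p ax) ws.
      by rewrite (mem_chords_opening_right s' t' p ax) h.
    * apply: (IHt _ None (x + weight s)); [by []|by move: w => /=; lia|].
      move=> p; rewrite (mem_chords_closing_right x s t p) ws.
      by rewrite (mem_chords_closing_right x s' t' p) h.
Qed.

(** Induction on the length of the interval. If no arc leaves the first vertex, the tree is
    a [Leaf] or a [Unary] node. Otherwise the cut point is the one described at [chords_inj]:
    an arc passing over it would cross an arc of the fan. *)
Lemma chords_surj n (D : {pred nat * nat}) : noncrossing D ->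
  (forall x, {in D, forall p, in_range None x n.+1 p} ->
     exists2 t, weight t = n.+1 & chords None x t =i D) /\
  (forall a x, a < x -> {in D, forall p, in_range (Some a) x n.+1 p} ->
     exists2 t, weight t = n.+1 & chords (Some a) x t =i D).
Proof.
elim/ltn_ind: n D => n IH D Dnc.
have IHP m (E : {pred nat * nat}) y : m < n -> {subset E <= D} -> {in E, forall p, in_range
  None y m.+1 p} ->
    exists2 t, weight t = m.+1 & chords None y t =i E.
  move=> mn ED; apply: (IH m mn E _).1 => p q pE qE.
  exact: Dnc (ED _ pE) (ED _ qE).
have IHQ m (E : {pred nat * nat}) a y : m < n -> {subset E <= D} -> a < y ->
    {in E, forall p, in_range (Some a) y m.+1 p} ->
    exists2 t, weight t = m.+1 & chords (Some a) y t =i E.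
  move=> mn ED; apply: (IH m mn E _).2 => p q pE qE.
  exact: Dnc (ED _ pE) (ED _ qE).
split=> [x rD|a x ax rD].
- have [hx|hx] := boolP (has (fun j => (x, j) \in D) (iota x n.+2)); last first.
    have nox j : (x, j) \in D = false.
      apply/negP => xj; case/negP: hx; apply/hasP; exists j => //.
      by have := rD _ xj; rewrite mem_iota /=; lia.
    case: n {hx} IH IHP IHQ rD => [|n] IH IHP IHQ rD.
      exists Leaf => // -[i j]; rewrite /= in_nil; apply/esym/negP => /rD /=; lia.
    have [||||t wt ht] := IHQ n D x.+1 x.+2 => //.
      move=> [i j] ijD; have := rD _ ijD; rewrite /=.
      have : i != x by apply: contraTneq ijD => ->; rewrite nox.
      by lia.
    by exists (Unary t); rewrite /= ?wt.
  have ex : exists j, (x, j) \in D by case/hasP: hx => j _; exists j.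
  have bd j : (x, j) \in D -> j <= x + n.+1 by move/rD => /=; lia.
  (* [w] is the end of the first edge, [u] the first point joined to [w]; when no arc joins
     them, it is through the side from [w.-1] to [w]. *)
  case: (ex_maxnP ex bd) => w xw wmax {ex bd hx}.
  have xwr := rD _ xw; rewrite /= in xwr.
  have ex : exists u, (x < u) && ((u.+1 == w) || ((u, w) \in D)).
    by exists w.-1; apply/andP; split; lia.
  case: (ex_minnP ex) => u /andP[xu uw] umin {ex}.
  have ltuw : u < w by case/orP: uw => [|/rD /=]; lia.
  have [|||s ws hs] := IHP (u - x).-1 [pred p in D | p.2 <= u] x; first by lia.
  - by move=> p /andP[].
  - by move=> [i j] /andP[/rD] /=; lia.
  have [|||t wt ht] := IHP (x + n - u) [pred p in D | u <= p.1] u; first by lia.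
  - by move=> p /andP[].
  - by move=> [i j] /andP[/rD] /=; lia.
  have us : x + weight s = u by lia.
  have tE : tip u t = w.
    have := tip_gt u t.
    have noj j : (u, j) \in D -> j <= w.
      by move=> uj; have := Dnc _ _ xw uj; rewrite /cross /=; lia.
    have le1 : tip u t <= w.
      case: (tip_chord t u) => [->|] //; rewrite ht => /andP[] + _; exact: noj.
    case/orP: uw => [/eqP|uw]; first by lia.
    have := @tip_unjumped t u (u, w); rewrite ht inE /= uw leqnn => /(_ isT); lia.
  exists (Bin s t); first by rewrite /= ws wt; lia.
  move=> [i j]; rewrite /= us tE inE mem_cat hs ht !inE xpair_eqE /=.
  have [ijD|] := boolP ((i, j) \in D); last by case: eqP => [->|] //=; case: eqP => [->|] //=;
    rewrite xw.
  rewrite /=; have ijr := rD _ ijD; rewrite /= in ijr.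
  have c1 := Dnc _ _ ijD xw; have c2 := Dnc _ _ xw ijD; rewrite /cross /= in c1 c2.
  have m1 : (i == x) ==> (j <= w) by apply/implyP => /eqP e; apply: wmax; rewrite -e.
  have m2 : (x < i) && (j == w) ==> (u <= i).
    by apply/implyP => /andP[xi /eqP e]; apply: umin; rewrite xi -e ijD orbT.
  case/orP: uw => [|uwD]; first by lia.
  by have c3 := Dnc _ _ ijD uwD; rewrite /cross /= in c3; lia.
- have [hx|hx] := boolP (has (fun j => (a, j) \in D) (iota x n.+2)); last first.
    have nox j : (a, j) \in D = false.
      apply/negP => aj; case/negP: hx; apply/hasP; exists j => //.
      by have := rD _ aj; rewrite mem_iota /=; lia.
    have rD' i j : (i, j) \in D -> [&& x <= i, i.+1 < j & j < x + n.+1].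
      move=> ijD; have : i != a by apply: contraTneq ijD => ->; rewrite nox.
      by have := rD _ ijD; rewrite /=; lia.
    case: n {hx} IH IHP IHQ rD rD' => [|n] IH IHP IHQ rD rD'.
      exists Leaf => // -[i j]; rewrite /= in_nil; apply/esym/negP => /rD' /=; lia.
    have [|||t wt ht] := IHP n D x => //.
      by move=> [i j] /rD' /=; lia.
    by exists (Unary t); rewrite /= ?wt.
  have ex : exists j, (a, j) \in D by case/hasP: hx => j _; exists j.
  (* [u] is the first point joined to the apex [a]. *)
  case: (ex_minnP ex) => u au umin {ex hx}.
  have aur := rD _ au; rewrite /= in aur.
  have [|||s ws hs] := IHP (u - x).-1 [pred p in D | (x <= p.1) && (p.2 <= u)] x; first by lia.
  - by move=> p /andP[].
  - by move=> [i j] /andP[/rD] /=; lia.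
  have [||||t wt ht] := IHQ (x + n - u) [pred p in D | (u <= p.1) || (p.1 == a) && (u < p.2)] a u;
    first by lia.
  - by move=> p /andP[].
  - by lia.
  - by move=> [i j] /andP[/rD] /=; lia.
  have us : x + weight s = u by lia.
  exists (Bin s t); first by rewrite /= ws wt; lia.
  move=> [i j]; rewrite /= us inE mem_cat hs ht !inE xpair_eqE /=.
  have [ijD|] := boolP ((i, j) \in D); last by case: eqP => [->|] //=; case: eqP => [->|] //=;
    rewrite au.
  rewrite /=; have ijr := rD _ ijD; rewrite /= in ijr.
  have c2 := Dnc _ _ au ijD; rewrite /cross /= in c2.
  have m1 : (i == a) ==> (u <= j) by apply/implyP => /eqP e; apply: umin; rewrite -e.
  by lia.
Qed.

(** * Codes of trees *)

(** A letter [(o, e)] stands for [o] nodes [Bin] followed by a [Unary] node if [e] holds and by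
    a [Leaf] otherwise. The right subtree of a [Bin] node is read before the left one, so that
    the nodes of a fan are consecutive. *)
Definition letter : Type := (nat * bool)%type.

Fixpoint lead (t : tree) : letter :=
  match t with
  | Leaf => (0, false)
  | Unary _ => (0, true)
  | Bin s t => ((lead t).1.+1, (lead t).2)
  end.

Fixpoint rest (t : tree) : seq letter :=
  match t with
  | Leaf => [::]
  | Unary t => lead t :: rest t
  | Bin s t => rest t ++ lead s :: rest s
  end.

Definition code (t : tree) : seq letter := lead t :: rest t.

Definition arity (l : letter) : nat := l.1 + l.2.

Definition arities (w : seq letter) : nat := sumn (map arity w).

Lemma arities_cat u v : arities (u ++ v) = arities u + arities v.
Proof. by rewrite /arities map_cat sumn_cat. Qed.

Lemma arities_cons l w : arities (l :: w) = arity l + arities w.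
Proof. by []. Qed.

Lemma size_code t : size (code t) = weight t.
Proof.
rewrite /code /=; elim: t => //= [t ->//|s IHs t IHt].
by rewrite size_cat /= -IHs -IHt; lia.
Qed.

Lemma arities_code t : (arities (code t)).+1 = weight t.
Proof.
rewrite /code arities_cons; elim: t => //= [t|s IHs t IHt].
  by rewrite arities_cons => <-.
by rewrite arities_cat arities_cons -IHs -IHt /arity /=; lia.
Qed.

(** The Lukasiewicz condition: before its last letter, the code always leaves a subtree to be
    read. *)
Lemma arities_take_code t i : i < weight t -> i <= arities (take i (code t)).
Proof.
elim: t i => [|t IH|s IHs t IHt] [|i] //= lti.
  by rewrite arities_cons /arity /= add0n add1n ltnS; apply: IH.
rewrite arities_cons take_cat; case: (ltnP i (size (rest t))) => h.
  have := IHt i.+1; rewrite -size_code /code /= ltnS => /(_ h).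
  by rewrite arities_cons /arity /=; lia.
rewrite arities_cat; have := arities_code t; have := size_code t.
rewrite /code arities_cons /= => st at1.
have := IHs (i - size (rest t)); rewrite /code /=.
by rewrite /arity /= in at1 *; lia.
Qed.

Lemma code_cat_inj t t' w w' : code t ++ w = code t' ++ w' -> t = t' /\ w = w'.
Proof.
elim: t t' w w' => [|t IH|s IHs t IHt] [|t'|s' t'] w w' //=; rewrite /code /=.
- by case.
- by case=> e1 e2; have /IH[-> ->] : code t ++ w = code t' ++ w' by rewrite /code /= e1 e2.
- case=> e1 e2; rewrite -!catA => e3.
  have /IHt[-> /IHs[-> ->]//] : code t ++ (code s ++ w) = code t' ++ (code s' ++ w').
  by rewrite /code /= (surjective_pairing (lead t)) e1 e2 -surjective_pairing e3.
Qed.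

Lemma code_inj : injective code.
Proof.
by move=> t t' e; case: (@code_cat_inj t t' [::] [::]); rewrite ?cats0.
Qed.

(** If a proper rotation were a code, both pieces of the word would be proper prefixes of
    codes, and the arities would add up to at least the number of letters. *)
Lemma rot_code_neq t t' r : weight t = weight t' -> 0 < r < weight t ->
  rot r (code t) != code t'.
Proof.
move=> w /andP[r0 rw]; apply/eqP => e.
have h1 := arities_take_code rw.
have h2 : weight t - r <= arities (drop r (code t)).
  have -> : drop r (code t) = take (weight t - r) (code t').
    by rewrite -e /rot take_cat size_drop size_code ltnn subnn take0 cats0.
  by apply: arities_take_code; lia.
have := arities_code t; rewrite -{1}(cat_take_drop r (code t)) arities_cat; lia.
Qed.

Lemma rot_code_inj t t' r r' : weight t = weight t' -> r < weight t -> r' < weight t ->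
  rot r (code t) = rot r' (code t') -> t = t' /\ r = r'.
Proof.
move=> w; wlog le : t t' r r' w / r <= r'.
  move=> H rw rw' e; case: (leqP r r') => [/H|/ltnW /H]; first exact.
  by case/(_ t' t (esym w)); rewrite -?w.
move=> rw rw' e.
have e2 : code t = rot (r' - r) (code t').
  apply: (@rot_inj r); rewrite e -rotD ?subnKC //.
  by rewrite size_code -w ltnW.
case: (posnP (r' - r)) e2 => [r0|rp] e2.
  by rewrite r0 rot0 in e2; split; [exact: code_inj|lia].
by have := @rot_code_neq t' t (r' - r) (esym w); rewrite -e2 eqxx; move=> /(_ _)/negPf; lia.
Qed.

(** Scans for a letter [(i, true)] read in a right-hand fan and followed by a letter with first
    component [j], where [m <= i + j]. The boolean [b] tells that the current fan is a left-hand
    one. *)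
Fixpoint fan_seen (m : nat) (b : bool) (w : seq letter) : bool :=
  if w is l :: w' then
    [&& ~~ b, l.2 & (if w' is l' :: _ then m <= l.1 + l'.1 else false)]
    || fan_seen m (l.2 && ~~ b) w'
  else false.

Definition incident (v : nat) (p : nat * nat) : bool := (p.1 == v) || (p.2 == v).

Lemma last_code t : (last (0, false) (code t)).2 = false.
Proof. by rewrite /code; elim: t => //= s IHs t IHt; rewrite last_cat /=. Qed.

Lemma fan_seen_cons m b l w :
  fan_seen m b (l :: w) =
    [&& ~~ b, l.2 & (if w is l' :: _ then m <= l.1 + l'.1 else false)]
    || fan_seen m (l.2 && ~~ b) w.
Proof. by []. Qed.

(** A [Leaf] completes a subtree, and the next subtree starts with a right-hand fan. *)
Lemma fan_seen_cat m b l u v : (last l u).2 = false ->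
  fan_seen m b (l :: u ++ v) = fan_seen m b (l :: u) || fan_seen m false v.
Proof.
elim: u l b => [|l' u IH] l b h.
  by rewrite /= in h *; rewrite h /= andbF orbF.
by rewrite cat_cons fan_seen_cons [in RHS]fan_seen_cons (IH l' _ h) orbA.
Qed.

Lemma count_opening t a x : a < x ->
  count (fun p => p.1 == a) (chords (Some a) x t) = (lead t).1.
Proof.
have nil y u : a < y -> count (fun p => p.1 == a) (chords None y u) = 0.
  move=> ay; apply/eqP; rewrite -leqn0 leqNgt -has_count; apply/hasPn => p.
  by move/(@chords_range u None y p isT) => /= /and3P[? _ _]; lia.
elim: t x => [|t IH|s _ t IHt] x ax //=; first exact: nil.
by rewrite eqxx count_cat nil // IHt // ltn_addr.
Qed.

(** The right-hand fan brings [(lead t).1] arcs to the tip, and the left-hand fan at the same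
    vertex, described by the next letter, adds its own. *)
Lemma count_closing t x : (lead t).2 ->
  (lead t).1 + (head (0, false) (rest t)).1 <= count (incident (tip x t)) (chords None x t).
Proof.
elim: t x => [|t _|s _ t IHt] x //= h.
  rewrite add0n -(@count_opening t x.+1 x.+2) //.
  by apply: sub_count => p /= /eqP pa; rewrite /incident pa eqxx.
rewrite {1}/incident eqxx orbT count_cat.
have e : head (0, false) (rest t ++ lead s :: rest s) = head (0, false) (rest t).
  by case: t h {IHt} => //= [s1 t]; case: (rest t) => // ; elim: t => //.
rewrite e; have := IHt (x + weight s) h; lia.
Qed.

(** This is what the alternation of fans is for: a pattern of two adjacent letters forces a
    vertex of large degree. *)
Lemma fan_seen_incident m t f x : apex_ok f x ->
  fan_seen m (isSome f) (code t) -> exists v, m <= count (incident v) (chords f x t).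
Proof.
elim: t f x => [|t IH|s IHs t IHt] f x ax.
- by rewrite /= andbF.
- rewrite /code /=; case: f ax => [a|] ax /=.
    by move/(IH None x isT).
  case/orP => [h|].
    exists x.+1; apply: leq_trans h _; rewrite add0n -(@count_opening t x.+1 x.+2) //.
    by apply: sub_count => p /= /eqP pa; rewrite /incident pa eqxx.
  exact: (IH (Some x.+1) x.+2 (ltnSn _)).
- have -> : code (Bin s t) = ((lead t).1.+1, (lead t).2) :: rest t ++ code s by [].
  rewrite fan_seen_cat; last first.
    by have := last_code t; rewrite /code /=; case: (rest t).
  case/orP; last first.
    move/(IHs None x isT) => [v hv]; exists v.
    have {}hv : m <= count (incident v) (chords None x s) by [].
    by case: f ax => [a|] ax /=; rewrite count_cat; lia.
  have deep : fan_seen m (isSome f) (code t) ->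
      exists v, m <= count (incident v) (chords f x (Bin s t)).
    case: f ax => [a|] ax.
      move/(IHt (Some a) (x + weight s) (ltn_addr _ ax)) => [v hv]; exists v.
      by rewrite /= count_cat; lia.
    move/(IHt None (x + weight s) isT) => [v hv]; exists v.
    by rewrite /= count_cat; lia.
  move=> /= /orP[/and3P[nf le2]|h]; last first.
    by apply: deep; rewrite /code /= h orbT.
  case: f ax nf deep => // _ _ _ h.
  exists (tip x (Bin s t)); apply: leq_trans (@count_closing (Bin s t) x le2) => /=.
  case: (rest t) h => [|l r] //=.
Qed.

(** * Words and the cycle lemma *)

(** The first letter ends with a [Leaf], so that [l1] is known to open a right-hand fan
    whatever precedes it. *)
Definition fan_triple (m : nat) (l0 l1 l2 : letter) : bool :=
  [&& ~~ l0.2, l1.2 & m <= l1.1 + l2.1].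

(** Only the triples at positions divisible by 3 are inspected, so that they are independent
    under a product measure. *)
Fixpoint fan_free (m : nat) (w : seq letter) : bool :=
  match w with
  | l0 :: l1 :: l2 :: w' => ~~ fan_triple m l0 l1 l2 && fan_free m w'
  | _ => true
  end.

Lemma fan_seen_catr m b u w : ~~ fan_seen m b (u ++ w) -> exists b', ~~ fan_seen m b' w.
Proof.
elim: u b => [|l u IH] b; first by exists b.
by rewrite cat_cons fan_seen_cons negb_or => /andP[_ /IH].
Qed.

Lemma fan_free_factor m b u w v : ~~ fan_seen m b (u ++ w ++ v) -> fan_free m w.
Proof.
case/fan_seen_catr => {u} {}b.
move: {2}(size w) (leqnn (size w)) => k.
elim: k w b => [|k IH] [|l0 [|l1 [|l2 w]]] b //; rewrite !cat_cons => sw h.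
rewrite /=; apply/andP; split.
  move: h; rewrite !fan_seen_cons !negb_or; apply: contraL => /and3P[h0 h1 h2].
  by rewrite (negPf h0) h1 h2 /= !andbF.
have /fan_seen_catr[b' hb'] : ~~ fan_seen m b ([:: l0; l1; l2] ++ w ++ v) by [].
by apply: IH hb'; move: sw => /=; lia.
Qed.

Definition letters (K : nat) : seq letter := [seq (o, e) | o <- iota 0 K, e <- [:: false; true]].

Fixpoint words (K n : nat) : seq (seq letter) :=
  if n is n'.+1 then [seq l :: w | l <- letters K, w <- words K n'] else [:: [::]].

Lemma mem_letters K l : (l \in letters K) = (l.1 < K).
Proof.
apply/allpairsP/idP => [[[j e] /= [+ _ ->]]|h]; first by rewrite mem_iota.
exists l; split; [by rewrite mem_iota|by case: l {h} => j []|by case: l {h}].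
Qed.

Lemma mem_words K n w : (w \in words K n) = (size w == n) && all (fun l => l.1 < K) w.
Proof.
elim: n w => [|n IH] [|l w] //=.
  by apply/negbTE/negP => /allpairsP[[? ?] [_ _]].
rewrite eqSS andbCA -IH -mem_letters;
  apply/allpairsP/andP => [[[l' w'] /= [? ? [-> ->]]]|[h1 h2]] //.
by exists (l, w).
Qed.

Lemma arity_all w K : arities w < K -> all (fun l => l.1 < K) w.
Proof.
elim: w => //= l w IH; rewrite arities_cons /arity => h.
by rewrite IH; lia.
Qed.

Lemma big_words_cons (R : Type) (idx : R) (op : Monoid.law idx) K n (F : seq letter -> R) :
  \big[op/idx]_(w <- words K n.+1) F w =
  \big[op/idx]_(l <- letters K) \big[op/idx]_(w <- words K n) F (l :: w).
Proof. by rewrite /= big_allpairs_dep. Qed.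

Lemma big_words_cat (R : Type) (idx : R) (op : Monoid.law idx) K h k (F : seq letter -> R) :
  \big[op/idx]_(w <- words K (h + k)) F w =
  \big[op/idx]_(u <- words K h) \big[op/idx]_(v <- words K k) F (u ++ v).
Proof.
elim: h F => [|h IH] F; first by rewrite add0n big_seq1.
rewrite addSn !big_words_cons; apply: eq_bigr => l _; rewrite IH.
by apply: eq_bigr => u _; apply: eq_bigr => v _.
Qed.

(** The injective half of the cycle lemma. A rotation can create patterns only across its
    seam, and the half of the rotated code that does not contain the seam is a factor of the
    code. *)
Lemma avoiding_trees_bound m n h (s : seq tree) : 0 < n -> h <= n ->
  uniq s -> {in s, forall t, weight t = n /\ ~~ fan_seen m true (code t)} ->
  n * size s <=
    count (fun w => ((arities w).+1 == n) && fan_free m (take h w)) (words n n) +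
    count (fun w => ((arities w).+1 == n) && fan_free m (drop h w)) (words n n).
Proof.
move=> n0 hn us hs.
pose rots := [seq rot r (code t) | r <- iota 0 n, t <- s].
have urots : uniq rots.
  apply: allpairs_uniq; rewrite ?iota_uniq // => -[r t] [r' t'] /=.
  move=> /allpairsP[[a b] /= [ra tb [-> ->]]] /allpairsP[[a' b'] /= [ra' tb' [-> ->]]] e.
  have [wb _] := hs _ tb; have [wb' _] := hs _ tb'.
  by case: (@rot_code_inj b b' a a') => //; rewrite ?wb ?wb' // -?[_ < _]mem_iota;
    [move: ra | move: ra' | move=> -> ->]; rewrite ?mem_iota.
have -> : n * size s = size rots by rewrite size_allpairs size_iota.
rewrite -!size_filter -size_cat; apply: uniq_leq_size => // w.
case/allpairsP => -[r t] /= [+ ts ->]; rewrite mem_iota add0n /= => rn.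
have [wt nf] := hs _ ts.
have sz : size (code t) = n by rewrite size_code.
have ar : (arities (rot r (code t))).+1 = n.
  rewrite -wt -arities_code -{2}(cat_take_drop r (code t)) /rot !arities_cat; lia.
rewrite mem_cat !mem_filter ar eqxx /= -andb_orl mem_words size_rot sz eqxx /=.
apply/andP; split; last by apply: arity_all; lia.
have dS : size (drop r (code t)) = n - r by rewrite size_drop sz.
rewrite /rot take_cat drop_cat dS; case: (ltnP h (n - r)) => hr.
  apply/orP; left; apply: (@fan_free_factor m true (take r (code t)) _ (drop h (drop r (code
    t)))).
  by rewrite !cat_take_drop.
apply/orP; right; rewrite -[drop _ _]cats0.
apply: (@fan_free_factor m true (take (h - (n - r)) (take r (code t))) _ (drop r (code t))).
by rewrite cats0 catA !cat_take_drop.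
Qed.

(** * Delannoy numbers and the number of forests *)

(** Number of lattice paths from (0, 0) to (p, q) with steps (1, 0), (0, 1) and (1, 1). *)
Definition delannoy (p q : nat) : nat := \sum_(i < p.+1) 2 ^ i * ('C(p, i) * 'C(q, i)).

Lemma delannoy_wide K p q : p < K -> delannoy p q = \sum_(i < K) 2 ^ i * ('C(p, i) * 'C(q, i)).
Proof.
move=> pK; rewrite /delannoy (big_ord_widen K (fun i => 2 ^ i * ('C(p, i) * 'C(q, i)))) //.
rewrite big_mkcond; apply: eq_bigr => i _; case: ltnP => // pi.
by rewrite bin_small // muln0.
Qed.

Lemma delannoyC p q : delannoy p q = delannoy q p.
Proof.
rewrite (@delannoy_wide (p + q).+1) ?ltnS ?leq_addr // (@delannoy_wide (p + q).+1 q) ?ltnS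
  ?leq_addl //.
by apply: eq_bigr => i _; rewrite ['C(p, i) * _]mulnC.
Qed.

Lemma delannoy0 q : delannoy 0 q = 1.
Proof. by rewrite /delannoy big_ord1 !bin0. Qed.

Lemma delannoySl p q :
  delannoy p.+1 q = delannoy p q + \sum_(i < p.+1) 2 ^ i.+1 * ('C(p, i) * 'C(q, i.+1)).
Proof.
rewrite (@delannoy_wide p.+2 p) // /delannoy big_ord_recl [X in _ = X + _]big_ord_recl /=.
rewrite !bin0 -addnA; congr (_ + _).
rewrite -big_split /=; apply: eq_bigr => i _; rewrite /bump /= add1n binS; lia.
Qed.

Lemma delannoyS p q :
  delannoy p.+1 q.+1 = delannoy p q.+1 + delannoy p.+1 q + delannoy p q.
Proof.
rewrite !delannoySl -!addnA; congr (_ + _).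
rewrite addnCA addnn /delannoy -muln2 big_distrl /= -big_split /=.
by apply: eq_bigr => i _; rewrite binS expnS; lia.
Qed.

(** The inequality only comes from the truncation of the alphabet at [K]. The induction sets
    the two letters without [Bin] apart and removes one [Bin] from all others. *)
Lemma sum_delannoy_letters K y k :
  \sum_(l <- letters K | arity l <= y) delannoy (y - arity l) k <= delannoy y k.+1.
Proof.
rewrite /letters -[iota 0 K]/(iota 0 K).
have E K' (F : letter -> nat) : \sum_(l <- letters K'.+1) F l =
    F (0, false) + F (0, true) + \sum_(l <- letters K') F (l.1.+1, l.2).
  rewrite /letters !big_allpairs_dep /= big_cons !big_cons big_nil addn0; congr (_ + _).
  rewrite -[1%N]addn0 iotaDl big_map; apply: eq_bigr => o _.
  by rewrite !big_cons !big_nil.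
rewrite -/(letters K) big_mkcond.
elim: y K => [|y IH] [|K]; rewrite ?[letters 0]/= ?big_nil // E /arity /=.
- by rewrite !delannoy0 big1.
- rewrite !addn0 subn0 add0n subn1 /= delannoyS.
  rewrite [delannoy y k.+1 + _]addnC -addnA -addnA; rewrite leq_add2l addnC leq_add2r.
  apply: leq_trans (IH K); apply: leq_sum => l _.
  by rewrite /arity addSn ltnS subSS.
Qed.

Lemma count_words_arities K k y :
  count (fun w => arities w == y) (words K k) <= delannoy y k.
Proof.
elim: k y => [|k IH] y.
  rewrite /= addn0 delannoyC delannoy0; exact: leq_b1.
rewrite -sum1_count big_mkcond big_words_cons; apply: leq_trans (@sum_delannoy_letters K y k).
rewrite [leqRHS]big_mkcond; apply: leq_sum => l _.
case: (leqP (arity l) y) => ly.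
  apply: leq_trans (IH (y - arity l)); rewrite -sum1_count [leqRHS]big_mkcond.
  apply: leq_sum => w _; rewrite arities_cons.
  by have -> : (arity l + arities w == y) = (arities w == y - arity l) by apply/eqP/eqP; lia.
rewrite big1 // => w _; rewrite arities_cons; case: eqP => //; lia.
Qed.

Definition grow_unary (F : seq tree) : seq tree :=
  if F is t :: F' then Unary t :: F' else [::].

Definition grow_bin (F : seq tree) : seq tree :=
  if F is s :: t :: F' then Bin s t :: F' else [::].

(** Sorts the forests of [k] trees and total weight [n] by the root of the first tree. The fuel
    [d] bounds the number of nodes still to be chosen, which is at most [2 * n - k]. *)
Fixpoint forests (d k n : nat) : seq (seq tree) :=
  match k, d with
  | 0, _ => if n == 0 then [:: [::]] else [::]
  | _.+1, 0 => [::]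
  | k'.+1, d'.+1 =>
      (if n is n'.+1 then
         [seq Leaf :: F | F <- forests d' k' n'] ++ [seq grow_unary F | F <- forests d' k n']
       else [::]) ++ [seq grow_bin F | F <- forests d' k.+1 n]
  end.

Lemma forests_small d k n : n < k -> forests d k n = [::].
Proof.
elim: d k n => [|d IH] [|k] n // nk.
case: n nk => [|n] nk /=; first by rewrite IH.
by rewrite !IH //; lia.
Qed.

Definition forest_weight (F : seq tree) : nat := sumn (map weight F).

Lemma forest_weight_ge F : size F <= forest_weight F.
Proof. by rewrite /forest_weight; elim: F => //= t F; have := weight_gt0 t; lia. Qed.

Lemma mem_forests d k n F : n.*2 - k <= d ->
  (F \in forests d k n) = (size F == k) && (forest_weight F == n).
Proof.
elim: d k n F => [|d IH] [|k] n F; rewrite -?muln2 => hd.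
- by rewrite /=; case: n hd => [|n] _; case: F => [|t F] //=.
- rewrite in_nil; apply/esym/negbTE/negP => /andP[/eqP s /eqP w].
  by have := forest_weight_ge F; rewrite s w; lia.
- by rewrite /=; case: n hd => [|n] _; case: F => [|t F] //=.
- case: n hd => [|n] hd.
    rewrite forests_small // in_nil; apply/esym/negbTE/negP => /andP[/eqP s /eqP w].
    by have := forest_weight_ge F; rewrite s w; lia.
  have I1 G := IH k n G ltac:(lia); have I2 G := IH k.+1 n G ltac:(lia).
  have I3 G := IH k.+2 n.+1 G ltac:(lia).
  rewrite /= !mem_cat -orbA; apply/idP/idP.
    case/or3P => /mapP[G]; rewrite ?I1 ?I2 ?I3 => /andP[/eqP s /eqP w] ->.
    + by rewrite /forest_weight /= -/(forest_weight G) s w ?add1n !eqxx.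
    + by case: G s w => //= t G; rewrite /forest_weight /= => -> <-; rewrite addSn !eqxx.
    + by case: G s w => [|t1 [|t2 G]] //=; rewrite /forest_weight /= => -[->] <-;
      rewrite eqxx /= addnA.
  case: F => //= -[|t|s t] F /andP[/eqP[sF] /eqP wF].
  + apply/or3P/Or31/mapP; exists F => //.
    by rewrite I1 sF; rewrite /forest_weight /= in wF *; lia.
  + apply/or3P/Or32/mapP; exists (t :: F) => //.
    by rewrite I2 /= sF; rewrite /forest_weight /= in wF *; lia.
  + apply/or3P/Or33/mapP; exists (s :: t :: F) => //.
    by rewrite I3 /= sF; rewrite /forest_weight /= in wF *; lia.
Qed.

Lemma size_forests_mem d k n F : F \in forests d k n -> size F = k.
Proof.
elim: d k n F => [|d IH] [|k] n F //=.
- by case: ifP; rewrite ?inE // => _ /eqP ->.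
- by case: ifP; rewrite ?inE // => _ /eqP ->.
- case: n => [|n]; rewrite ?mem_cat.
    by case/mapP => G /IH; case: G => [|? []] //= ? ? [] + -> => /= ->.
  rewrite -orbA; case/or3P => /mapP[G /IH].
  + by move=> <- ->.
  + by case: G => //= t G e ->.
  + by case: G => [|? []] //= ? ? [] + -> => /= ->.
Qed.

Lemma forests_uniq d k n : uniq (forests d k n).
Proof.
elim: d k n => [|d IH] [|k] n; rewrite /= ?if_arg //; try by case: ifP.
have U3 : uniq [seq grow_bin F | F <- forests d k.+2 n].
  rewrite map_inj_in_uniq //; move=> F G /size_forests_mem + /size_forests_mem.
  by case: F => [|? []] //; case: G => [|? []] // ? ? ? ? /= _ _ [-> -> ->].
case: n U3 => [|n] //= U3.
rewrite cat_uniq U3 andbT cat_uniq map_inj_uniq ?IH /=; last by move=> F G [].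
rewrite map_inj_in_uniq ?IH ?andbT; last first.
  move=> F G /size_forests_mem + /size_forests_mem.
  by case: F => // ? ?; case: G => // ? ? /= _ _ [-> ->].
apply/andP; split.
  apply/hasPn => H /mapP[G /size_forests_mem + ->].
  by case: G => // t G _; apply/negP => /mapP[? _].
apply/hasPn => H /mapP[G /size_forests_mem + ->].
case: G => [|s [|t G]] // _; rewrite mem_cat; apply/negP => /orP[] /mapP[G' + //].
by move/size_forests_mem; case: G'.
Qed.

(** The reflection principle: the difference of the two Delannoy numbers satisfies the
    recurrence of [forests] and vanishes on the diagonal. *)
Lemma size_forests d p k : p.*2 + k < d ->
  size (forests d k.+1 (p + k.+1)) + (if p is r.+1 then delannoy r (p + k.+1) else 0) =
  delannoy p (p + k).
Proof.
elim: d p k => // d IH p k hd.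
rewrite /= addnS /= size_cat size_cat !size_map -addnS.
case: p hd => [|r] hd.
  rewrite [forests d k.+1 _]forests_small // [forests d k.+2 _]forests_small // addn0 delannoy0.
  rewrite !addn0 add0n; case: k hd => [|k] hd; first by case: (d).
  have := IH 0 k; rewrite add0n addn0 delannoy0 => -> //; lia.
have S1 : size (forests d k (r.+1 + k)) + delannoy r (r.+1 + k) = delannoy r.+1 (r + k).
  case: k hd => [|k] hd; last by have := IH r.+1 k ltac:(lia); rewrite (addSnnS r k).
  by rewrite !addn0 delannoyC; case: (d).
have S2 := IH r k ltac:(lia); have S3 := IH r k.+1 ltac:(lia).
rewrite ?addnS ?addSn in S1 S2 S3 *.
rewrite delannoyS.
case: r hd S1 S2 S3 => [|r] hd S1 S2 S3; first by rewrite !delannoy0 in S1 S2 S3 *; lia.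
rewrite ?addnS ?addSn in S1 S2 S3 *.
have := delannoyS r (r + k).+2.
lia.
Qed.

(** The difference of Delannoy numbers, evaluated term by term; the factor [k.+1] over [n] is
    the one of the cycle lemma. *)
Lemma size_forests_closed d r k n : n = r + k.+2 -> n.*2 <= d ->
  n * size (forests d k.+1 n) = k.+1 * \sum_(i < r.+1) 2 ^ i.+1 * ('C(r, i) * 'C(n, i.+1)).
Proof.
move=> nE hd; have := @size_forests d r.+1 k ltac:(lia).
have -> : r.+1 + k.+1 = n by lia.
set f := size _ => e.
pose m := (r + k).+1; have nm : n = m.+1 by rewrite /m; lia.
have mE : r.+1 + k = m by [].
rewrite mE delannoySl in e.
have e2 : f + \sum_(i < r.+1) 2 ^ i.+1 * ('C(r, i.+1) * 'C(m, i)) =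
     \sum_(i < r.+1) 2 ^ i.+1 * ('C(r, i) * 'C(m, i.+1)).
  have X : delannoy r n = delannoy r m + \sum_(i < r.+1) 2 ^ i.+1 * ('C(r, i.+1) * 'C(m, i)).
    rewrite !(@delannoy_wide r.+2 r) // big_ord_recl [X in _ = X + _]big_ord_recl /=.
    rewrite !bin0 -addnA; congr (_ + _).
    by rewrite -big_split /=; apply: eq_bigr => i _; rewrite /bump /= add1n nm binS; lia.
  by rewrite X in e; lia.
apply/eqP; rewrite -(eqn_add2r (n * \sum_(i < r.+1) 2 ^ i.+1 * ('C(r, i.+1) * 'C(m, i)))).
rewrite -mulnDr e2 !big_distrr -big_split /=; apply/eqP/eq_bigr => i _.
have h1 : n * 'C(m, i) = i.+1 * 'C(n, i.+1) by rewrite nm mul_bin_diag.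
have h2 : n * 'C(m, i.+1) = (m - i) * 'C(n, i.+1).
  have X : n * 'C(n, i.+1) = n * 'C(m, i.+1) + n * 'C(m, i) by rewrite {2}nm binS mulnDr.
  by rewrite h1 in X; have := ltn_ord i; rewrite mulnBl; nia.
have h3 : i.+1 * 'C(r, i.+1) = (r - i) * 'C(r, i) by rewrite mul_bin_left.
transitivity (2 ^ i.+1 * 'C(r, i) * (n * 'C(m, i.+1))); first by ring.
transitivity (k.+1 * (2 ^ i.+1 * ('C(r, i) * 'C(n, i.+1))) + 2 ^ i.+1 * 'C(r, i.+1) * (n *
  'C(m, i)));
  last by ring.
rewrite h1 h2.
transitivity (k.+1 * (2 ^ i.+1 * ('C(r, i) * 'C(n, i.+1))) + 2 ^ i.+1 * (i.+1 * 'C(r, i.+1)) *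
  'C(n, i.+1));
  last by ring.
rewrite h3; have := ltn_ord i.
have -> : m - i = k.+1 + (r - i) by rewrite /m; have := ltn_ord i; lia.
by move=> _; ring.
Qed.

(** * Noncrossing sets of diagonals *)

Definition pair_val n (p : 'I_n * 'I_n) : nat * nat := (nat_of_ord p.1, nat_of_ord p.2).

Lemma pair_val_inj n : injective (@pair_val n).
Proof. by move=> [i j] [k l] [/val_inj -> /val_inj ->]. Qed.

Lemma ordSE n (i : 'I_n) : ordS i = (if i.+1 == n then 0 else i.+1) :> nat.
Proof.
rewrite /=; case: (i.+1 =P n) => [e|ne]; first by rewrite e modnn.
by rewrite modn_small //; have := ltn_ord i; lia.
Qed.

Lemma is_diagonalE n (p : 'I_n * 'I_n) :
  is_diagonal p = (p.1.+1 < p.2) && ~~ ((p.1 == 0 :> nat) && (p.2.+1 == n)).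
Proof.
have E (a b : 'I_n) : (a == b) = (nat_of_ord a == nat_of_ord b) by [].
case: p => i j; rewrite /is_diagonal /is_side /= !E !ordSE.
have := ltn_ord i; have := ltn_ord j.
by case: (i.+1 =P n) => ?; case: (j.+1 =P n) => ?; lia.
Qed.

Definition noncrossing_sets n : {set {set 'I_n * 'I_n}} :=
  [set D : {set 'I_n * 'I_n} | [forall p in D, is_diagonal p] &&
    [forall p in D, forall q in D, ~~ cross (pair_val p) (pair_val q)]].

Lemma noncrossing_setsP n (D : {set 'I_n * 'I_n}) :
  reflect ((forall p, p \in D -> is_diagonal p) /\
           (forall p q, p \in D -> q \in D -> ~~ cross (pair_val p) (pair_val q)))
          (D \in noncrossing_sets n).
Proof.
rewrite inE; apply: (iffP andP) => -[h1 h2]; split.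
- by move=> p pD; move/forall_inP: h1; apply.
- by move=> p q pD qD; move/forall_inP: h2 => /(_ p pD)/forall_inP; apply.
- exact/forall_inP.
- by apply/forall_inP => p pD; apply/forall_inP => q; exact: h2.
Qed.

Definition diagonal_degree n (D : {set 'I_n * 'I_n}) (v : 'I_n) : nat :=
  #|[set p in D | (p.1 == v) || (p.2 == v)]|.

Definition trees (n : nat) : seq tree := [seq head Leaf F | F <- forests n.*2 1 n].

Lemma mem_trees n t : (t \in trees n) = (weight t == n).
Proof.
apply/mapP/eqP => [[F + ->]|wt].
  rewrite mem_forests ?leq_subr // => /andP[/eqP sF /eqP <-].
  by case: F sF => [|u []] //= _; rewrite /forest_weight /= addn0.
by exists [:: t] => //; rewrite mem_forests ?leq_subr // /forest_weight /= addn0 wt eqxx.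
Qed.

Lemma trees_uniq n : uniq (trees n).
Proof.
rewrite map_inj_in_uniq ?forests_uniq // => F G.
by move=> /size_forests_mem + /size_forests_mem; case: F => [|? []] //;
  case: G => [|? []] // _ _ /= ->.
Qed.

Definition tree_set n (t : tree) : {set 'I_n * 'I_n} :=
  [set p | pair_val p \in chords (Some 0) 1 t].

(** Vertex 0 is taken as the apex of the first fan, so that its degree can be read off the
    first letter. *)
Lemma noncrossing_tree n (D : {set 'I_n * 'I_n}) : 2 < n -> D \in noncrossing_sets n ->
  exists2 t, weight t = n.-1 &
    chords (Some 0) 1 t =i [seq pair_val p | p <- enum D].
Proof.
case: n D => [|[|n]] // D n2 /noncrossing_setsP[h1 h2].
pose E : {pred nat * nat} := [in [seq pair_val p | p <- enum D]].
have nc : noncrossing E.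
  move=> _ _ /mapP[p + ->] /mapP[q + ->]; rewrite !mem_enum; exact: h2.
have [_ /(_ 0 1 isT)] := @chords_surj n E nc; apply.
move=> _ /mapP[[i j] + ->]; rewrite mem_enum => /h1; rewrite is_diagonalE /pair_val /=.
by have := ltn_ord j; lia.
Qed.

Lemma card_le_size (T : finType) (A : {set T}) (S : eqType) (f : T -> S) (s : seq S) :
  {in A &, injective f} -> {in A, forall x, f x \in s} -> #|A| <= size s.
Proof.
move=> inj sub; rewrite cardE -(size_map f); apply: uniq_leq_size.
  by rewrite map_inj_in_uniq ?enum_uniq // => x y; rewrite !mem_enum; exact: inj.
by move=> _ /mapP[x + ->]; rewrite mem_enum; exact: sub.
Qed.

Lemma card_le_trees n (A : {set {set 'I_n * 'I_n}}) (s : seq tree) : 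
  (forall D, D \in A -> exists2 t, t \in s & chords (Some 0) 1 t =i [seq pair_val p | p <- enum
    D]) ->
  #|A| <= size s.
Proof.
move=> h; rewrite -(size_map (@tree_set n)); apply: (@card_le_size _ A _ id) => //.
move=> D /h[t ts e]; apply/mapP; exists t => //.
by apply/setP => p; rewrite inE e mem_map ?mem_enum //; exact: pair_val_inj.
Qed.

Lemma count_incident n (D : {set 'I_n * 'I_n}) t (v : 'I_n) :
  chords (Some 0) 1 t =i [seq pair_val p | p <- enum D] ->
  diagonal_degree D v = count (incident v) (chords (Some 0) 1 t).
Proof.
move=> e; rewrite -size_filter /diagonal_degree cardE -(size_map (@pair_val n)).
apply: perm_size; apply: uniq_perm.
- by rewrite map_inj_uniq ?enum_uniq //; exact: pair_val_inj.
- by rewrite filter_uniq // chords_uniq.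
- move=> x; rewrite mem_filter e; apply/mapP/andP => [[p]|[+ /mapP[p + xp]]].
    rewrite mem_enum inE => /andP[pD pv ->]; split; first exact: pv.
    by apply/mapP; exists p; rewrite ?mem_enum.
  rewrite mem_enum xp => pv pD; exists p => //; rewrite mem_enum inE pD; exact: pv.
Qed.

Lemma card_sparse_le n m : 2 < n -> 0 < m ->
  #|[set D in noncrossing_sets n | [forall v, diagonal_degree D v < m]]| <=
  size [seq t <- trees n.-1 | ~~ fan_seen m true (code t)].
Proof.
move=> n2 m0; apply: card_le_trees => D; rewrite inE => /andP[Dnc /forallP lo].
have [t wt e] := noncrossing_tree n2 Dnc; exists t => //.
rewrite mem_filter mem_trees wt eqxx andbT; apply/negP.
move/(@fan_seen_incident m t (Some 0) 1 isT) => [v].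
have [vn|vn] := ltnP v n.
  have := lo (Ordinal vn); rewrite (count_incident _ e) /=; lia.
have -> : count (incident v) (chords (Some 0) 1 t) = 0; last by lia.
apply/eqP; rewrite -leqn0 leqNgt -has_count; apply/hasPn => p.
rewrite e => /mapP[[i j] _ ->]; rewrite /incident /=.
by have := ltn_ord i; have := ltn_ord j; lia.
Qed.

(** Inverse to stripping a tree of leading [Bin] nodes. *)
Definition bin_comb (F : seq tree) : tree :=
  if F is r :: ss then foldl (fun t s => Bin s t) r ss else Leaf.

Lemma lead_comb k t : k <= (lead t).1 ->
  exists2 F, size F = k.+1 & bin_comb F = t /\ forest_weight F = weight t.
Proof.
elim: k t => [|k IH] t; first by exists [:: t] => //; rewrite /forest_weight /= addn0.
case: t => //= s t /IH[[|r ss] //= [sz] [<- wt]].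
exists (r :: rcons ss s); first by rewrite /= size_rcons sz.
rewrite /= foldl_rcons; split => //.
by rewrite -wt /forest_weight /= map_rcons sumn_rcons; lia.
Qed.

(** The diagonals at vertex 0 correspond to the leading [Bin] nodes; stripping [k] of them leaves
    a forest of [k.+1] trees. *)
Lemma card_fan_le n k (v : 'I_n) : 2 < n -> v = 0 :> nat ->
  #|[set D in noncrossing_sets n | k <= diagonal_degree D v]| <=
  size (forests n.-1.*2 k.+1 n.-1).
Proof.
move=> n2 v0; rewrite -(size_map bin_comb); apply: card_le_trees => D.
rewrite inE => /andP[Dnc kD].
have [t wt e] := noncrossing_tree n2 Dnc; exists t => //.
move: kD; rewrite (count_incident _ e) v0.
rewrite (_ : count _ _ = (lead t).1); last first.
  rewrite -(@count_opening t 0 1) //; apply: eq_in_count => -[i j] /=.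
  by move/(@chords_range t (Some 0) 1 _ isT); rewrite /incident /=; lia.
case/lead_comb => F sF [tE wF]; rewrite -tE; apply: map_f.
by rewrite mem_forests ?leq_subr // sF wF wt !eqxx.
Qed.

(** A tree amounts to a noncrossing set of diagonals together with the presence or absence of
    the arc from 0 to [n.-1], which is a side of the polygon. *)
Lemma size_trees_le n : 2 < n -> size (trees n.-1) <= 2 * #|noncrossing_sets n|.
Proof.
case: n => [|n] // n2.
pose top : 'I_n.+1 * 'I_n.+1 := (ord0, ord_max).
pose f t := (tree_set n.+1 t :\ top, top \in tree_set n.+1 t).
have range t p : weight t = n -> p \in chords (Some 0) 1 t -> p.1 <= n /\ p.1.+1 < p.2 <= n.
  by move=> wt /(@chords_range t (Some 0) 1 _ isT) /=; rewrite wt; lia.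
have inj : {in trees n &, injective f}.
  move=> t t'; rewrite !mem_trees => /eqP wt /eqP wt' [e1 e2].
  apply: (@chords_inj t t' (Some 0) 1) => //; first by rewrite wt wt'.
  have e3 : tree_set n.+1 t = tree_set n.+1 t'.
    apply/setP => p; have := congr1 (fun A : {set _} => p \in A) e1; rewrite !in_setD1.
    by case: eqP => [->|_] //=.
  have sub u u' : weight u = n -> tree_set n.+1 u = tree_set n.+1 u' ->
      {subset chords (Some 0) 1 u <= chords (Some 0) 1 u'}.
    move=> wu eu [i j] h; have [/= i_n /andP[ij jn]] := range u _ wu h.
    have : (Ordinal (i_n : i < n.+1), Ordinal (jn : j < n.+1)) \in tree_set n.+1 u by rewrite inE.
    by rewrite eu inE.
  by move=> p; apply/idP/idP; apply: sub.
rewrite -(size_map f) -[2]card_bool mulnC -cardsT -cardsX.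
rewrite cardE; apply: uniq_leq_size.
  by rewrite map_inj_in_uniq // trees_uniq.
move=> _ /mapP[t + ->]; rewrite mem_trees => /eqP wt.
rewrite mem_enum finset.in_setX finset.in_setT andbT; apply/noncrossing_setsP; split.
  move=> p; rewrite in_setD1 inE => /andP[pt /(range _ _ wt) /= [_ /andP[h1 h2]]].
  rewrite is_diagonalE h1 /=; apply: contra pt => /andP[/eqP e1 /eqP e2].
  by case: p e1 e2 {h1 h2} => i j /= e1 [e2]; apply/eqP; congr pair; apply: val_inj.
move=> p q; rewrite !in_setD1 !inE => /andP[_ hp] /andP[_ hq].
exact: (@chords_noncrossing t (Some 0) 1 isT).
Qed.

Definition rotate_pair n (p : 'I_n * 'I_n) : 'I_n * 'I_n :=
  if ordS p.1 < ordS p.2 then (ordS p.1, ordS p.2) else (ordS p.2, ordS p.1).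

Lemma rotate_pairE n (i j : 'I_n) :
  pair_val (rotate_pair (i, j)) =
    let f x := if x.+1 == n then 0 else x.+1 in
    if f i < f j then (f i, f j) else (f j, f i).
Proof.
rewrite /rotate_pair [(i, j).1]/= [(i, j).2]/= !ordSE /=.
by case: ifP => _; rewrite /pair_val [(_, _).1]/= [(_, _).2]/= !ordSE.
Qed.

Lemma card_degree_rotate n k (v : 'I_n) :
  #|[set D in noncrossing_sets n | k <= diagonal_degree D v]| <=
  #|[set D in noncrossing_sets n | k <= diagonal_degree D (ordS v)]|.
Proof.
have ltp (p : 'I_n * 'I_n) : is_diagonal p -> p.1 < p.2 by case/andP.
have rinj : {in is_diagonal (n := n) &, injective (@rotate_pair n)}.
  move=> [i j] [k' l] /ltp /= ij /ltp /= kl; rewrite /rotate_pair /=.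
  have S := @ordS_inj n.
  by case: ifP => h1; case: ifP => h2 e; have /S /= e1 := congr1 fst e;
    have /S /= e2 := congr1 snd e; rewrite e1 e2 // in ij *; lia.
pose rot D := [set rotate_pair p | p in (D : {set 'I_n * 'I_n})].
have dg D : D \in noncrossing_sets n -> diagonal_degree D v <= diagonal_degree (rot D) (ordS v).
  move=> /noncrossing_setsP[h1 _].
  rewrite /diagonal_degree -(card_in_imset (f := @rotate_pair n)); last first.
    by move=> p q; rewrite !inE => /andP[/h1 hp _] /andP[/h1 hq _]; apply: rinj.
  apply: subset_leq_card; apply/fintype.subsetP => _ /imsetP[p + ->].
  rewrite !inE => /andP[pD pv]; rewrite imset_f //= /rotate_pair.
  by case/orP: pv => /eqP <-; case: ifP; rewrite eqxx ?orbT.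
have nc D : D \in noncrossing_sets n -> rot D \in noncrossing_sets n.
  move=> /noncrossing_setsP[h1 h2]; apply/noncrossing_setsP; split.
    move=> _ /imsetP[[i j] /h1 + ->]; rewrite !is_diagonalE.
    have e1 : nat_of_ord (rotate_pair (i, j)).1 = _ := congr1 fst (rotate_pairE i j).
    have e2 : nat_of_ord (rotate_pair (i, j)).2 = _ := congr1 snd (rotate_pairE i j).
    rewrite e1 e2 /= {e1 e2}; have := ltn_ord i; have := ltn_ord j.
    by case: (i.+1 =P n) => ?; case: (j.+1 =P n) => ? /=; (do ?[case: ifP => /= ?]); lia.
  move=> _ _ /imsetP[[i j] pD ->] /imsetP[[k' l] qD ->].
  have := h1 _ pD; have := h1 _ qD; have := h2 _ _ pD qD; have := h2 _ _ qD pD.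
  rewrite !is_diagonalE !rotate_pairE /cross /pair_val /=.
  have := ltn_ord i; have := ltn_ord j; have := ltn_ord k'; have := ltn_ord l.
  by case: (i.+1 =P n) => ?; case: (j.+1 =P n) => ?; case: (k'.+1 =P n) => ?;
    case: (l.+1 =P n) => ? /=; (do ?[case: ifP => /= ?]); lia.
rewrite -[leqLHS](card_in_imset (f := rot)); last first.
  move=> D D'; rewrite inE => /andP[/noncrossing_setsP[h1 _] _].
  rewrite inE => /andP[/noncrossing_setsP[h1' _] _] e.
  have sub (A B : {set 'I_n * 'I_n}) : (forall p, p \in A -> is_diagonal p) ->
      (forall p, p \in B -> is_diagonal p) -> rot A = rot B -> A \subset B.
    move=> hA hB eAB; apply/fintype.subsetP => p pA.
    have : rotate_pair p \in rot B by rewrite -eAB imset_f.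
    by case/imsetP => q qB /(rinj _ _ (hA _ pA) (hB _ qB)) ->.
  by apply/eqP; rewrite finset.eqEsubset !sub.
apply: subset_leq_card; apply/fintype.subsetP => _ /imsetP[D + ->].
by rewrite inE => /andP[Dnc kD]; rewrite inE (nc _ Dnc) (leq_trans kD) // dg.
Qed.

(** Rotations of the polygon carry any vertex to vertex 0. *)
Lemma card_degree_le n k (v : 'I_n) : 2 < n ->
  #|[set D in noncrossing_sets n | k <= diagonal_degree D v]| <=
  size (forests n.-1.*2 k.+1 n.-1).
Proof.
move=> n2; move: {2}(n - v) (erefl (n - v)) => d.
elim: d v => [|d IH] v dv; first by have := ltn_ord v; lia.
apply: leq_trans (card_degree_rotate k v) _.
case: (v.+1 =P n) => vn; last by apply: IH; rewrite ordSE; case: eqP => //; lia.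
by apply: card_fan_le => //; rewrite ordSE vn eqxx.
Qed.

Local Open Scope ring_scope.

(** * Binomial estimates *)

(** The value at which the logarithms are based; its inverse is G at its singularity b^-2. *)
Definition silver (R : rcfType) : R := 1 + Num.sqrt 2.

Lemma sqrt2_bounds (R : rcfType) : (1414 / 1000 : R) < Num.sqrt (2 : R) < 1415 / 1000.
Proof.
have h : Num.sqrt 2 ^+ 2 = 2 :> R by rewrite sqr_sqrtr.
have g : 0 <= Num.sqrt 2 :> R by rewrite sqrtr_ge0.
by apply/andP; split; nra.
Qed.

Lemma sqr_sqrt2 (R : rcfType) : Num.sqrt 2 * Num.sqrt 2 = 2 :> R.
Proof. by rewrite -expr2 sqr_sqrtr. Qed.

Lemma silver_bounds (R : rcfType) : (24 / 10 : R) < silver R < 25 / 10.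
Proof. by rewrite /silver; have /andP[] := sqrt2_bounds R; lra. Qed.

Lemma silver_gt0 (R : rcfType) : 0 < silver R.
Proof. by have /andP[] := silver_bounds R; lra. Qed.

(** The terms of the binomial expansion of (1 + sqrt 2)^q, that is, b^q times a binomial law. *)
Definition bterm (R : rcfType) (q i : nat) : R := 'C(q, i)%:R * Num.sqrt 2 ^+ i.

Lemma bterm_ge0 (R : rcfType) q i : 0 <= bterm R q i.
Proof. by rewrite mulr_ge0 // exprn_ge0 // sqrtr_ge0. Qed.

Lemma bterm_gt0 (R : rcfType) q i : (i <= q)%N -> 0 < bterm R q i.
Proof.
move=> iq; apply: mulr_gt0; first by rewrite ltr0n bin_gt0.
by apply: exprn_gt0; rewrite sqrtr_gt0.
Qed.

Lemma bterm_small (R : rcfType) q i : (q < i)%N -> bterm R q i = 0.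
Proof. by move=> qi; rewrite /bterm bin_small // mul0r. Qed.

Lemma bterm_next (R : rcfType) q i : (i <= q)%N ->
  i.+1%:R * bterm R q i.+1 = Num.sqrt 2 * (q%:R - i%:R) * bterm R q i.
Proof.
move=> iq; rewrite /bterm exprS.
have e : i.+1%:R * 'C(q, i.+1)%:R = (q%:R - i%:R) * 'C(q, i)%:R :> R.
  by rewrite -natrM mul_bin_left natrM natrB.
rewrite [LHS]mulrA e; ring.
Qed.

(** Pascal's rule, in the form of a recurrence for weighted sums. *)
Lemma bterm_sumS (R : rcfType) q (g : nat -> R) :
  \sum_(i < q.+2) bterm R q.+1 i * g i =
  \sum_(i < q.+1) bterm R q i * (g i + Num.sqrt 2 * g i.+1).
Proof.
rewrite big_ord_recl /= /bterm bin0.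
under [RHS]eq_bigr => i _ do rewrite mulrDr.
rewrite [RHS]big_split /= [X in _ = X + _](_ : _ = \sum_(i < q.+2) 'C(q, i)%:R * Num.sqrt 2 ^+
  i * g i).
  rewrite [in RHS]big_ord_recl /= bin0 -addrA; congr (_ + _).
  rewrite -big_split /=; apply: eq_bigr => i _; rewrite /bump /= add1n binS natrD exprS; ring.
by rewrite [RHS]big_ord_recr /= bin_small // !mul0r addr0.
Qed.

Lemma bterm_sum (R : rcfType) q : \sum_(i < q.+1) bterm R q i = silver R ^+ q.
Proof.
elim: q => [|q IH]; first by rewrite big_ord1 /bterm bin0 mul1r.
under eq_bigr => i _ do rewrite -[bterm _ _ _]mulr1.
rewrite (@bterm_sumS R q (fun=> 1)) -mulr_suml IH exprSr /silver; ring.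
Qed.

Lemma bterm_variance (R : rcfType) q :
  \sum_(i < q.+1) bterm R q i * (silver R * i%:R - Num.sqrt 2 * q%:R) ^+ 2 =
  q%:R * Num.sqrt 2 * silver R ^+ q.
Proof.
elim: q => [|q IH]; first by rewrite big_ord1 /= !mul0r !mulr0 subrr expr0n mulr0.
rewrite (@bterm_sumS R q (fun i => (silver R * i%:R - Num.sqrt 2 * q.+1%:R) ^+ 2)).
transitivity (\sum_(i < q.+1) (silver R * (bterm R q i * (silver R * i%:R - Num.sqrt 2 * q%:R)
  ^+ 2)
    + silver R * Num.sqrt 2 * bterm R q i)).
  apply: eq_bigr => i _; have h := sqr_sqrt2 R;
    rewrite /silver -[q.+1%:R]natr1 -[(nat_of_ord i).+1%:R]natr1.
  set x := Num.sqrt 2 in h *; set B := bterm _ _ _; set I := (nat_of_ord i)%:R; set Q := q%:R.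
  set y := (1 + x) * I - x * Q.
  have -> : (1 + x) * I - x * (Q + 1) = y - x by rewrite /y; ring.
  have -> : (1 + x) * (I + 1) - x * (Q + 1) = y + 1 by rewrite /y; ring.
  have -> : (y - x) ^+ 2 + x * (y + 1) ^+ 2 = (1 + x) * y ^+ 2 + x * x + x by ring.
  have -> : (1 + x) * (B * y ^+ 2) + (1 + x) * x * B = B * ((1 + x) * y ^+ 2 + x * x + x) by ring.
  by [].
rewrite big_split /= -!mulr_sumr IH bterm_sum exprS -[q.+1%:R]natr1; ring.
Qed.

Lemma bterm_le (R : rcfType) q i : bterm R q i <= silver R ^+ q.
Proof.
case: (leqP i q) => iq; last by rewrite bterm_small // exprn_ge0 // ltW // silver_gt0.
rewrite -bterm_sum (bigD1 (Ordinal (iq : (i < q.+1)%N))) //= lerDl.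
by apply: sumr_ge0 => j _; exact: bterm_ge0.
Qed.

Lemma bterm_sum_segment (R : rcfType) q m j :
  \sum_(i < j) bterm R q (m + i) <= silver R ^+ q.
Proof.
pose K := (q.+1 + (m + j))%N.
have -> : silver R ^+ q = \sum_(i < K) bterm R q i.
  rewrite -bterm_sum (big_ord_widen K (fun i => bterm R q i)) ?leq_addr // big_mkcond.
  by apply: eq_bigr => i _; case: ltnP => // qi; rewrite bterm_small.
have mj : (m + j <= K)%N by rewrite leq_addl.
rewrite -(big_mkord xpredT (fun i => bterm R q i)) (big_cat_nat (leq0n m) (leq_trans (leq_addr
  _ _) mj)) /=.
rewrite (big_cat_nat (leq_addr j m) mj) /=.
have -> : \sum_(m <= i < m + j) bterm R q i = \sum_(i < j) bterm R q (m + i).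
  rewrite -{1}[m]add0n big_addn addKn big_mkord; apply: eq_bigr => i _; by rewrite addnC.
by rewrite addrCA lerDl addr_ge0 //; apply: sumr_ge0 => i _; exact: bterm_ge0.
Qed.

(** One step of the lower bound by 1 - b j^2 / m for the product of the ratios of consecutive
    terms; the hypothesis on [y] bounds the ratio itself from below by 1 - b (j + 1) / m. *)
Lemma ratio_step (R : rcfType) (x m j y a0 a : R) :
  0 <= x -> 0 < m -> 0 <= j -> 0 <= a -> 0 <= a0 -> m - x * (j + 1) <= y ->
  (1 + x) * (j + 1) ^+ 2 < m ->
  (1 - (1 + x) * j ^+ 2 / m) * a0 <= a ->
  (m + j + 1) * ((1 - (1 + x) * (j + 1) ^+ 2 / m) * a0) <= y * a.
Proof.
move=> x0 m0 j0 a_ge a0_ge l1 pos IH.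
apply: (@le_trans _ _ ((m - x * (j + 1)) * a)); last exact: ler_wpM2r.
have p1 : 0 <= m - x * (j + 1).
  rewrite subr_ge0; apply: ltW; apply: le_lt_trans pos.
  have h : 0 <= j * (j + 1) by rewrite mulr_ge0 ?addr_ge0.
  have := mulr_ge0 x0 h; nra.
apply: (@le_trans _ _ ((m - x * (j + 1)) * ((1 - (1 + x) * j ^+ 2 / m) * a0)));
  last exact: ler_wpM2l.
rewrite mulrA [leRHS]mulrA; apply: ler_wpM2r => //.
rewrite ![(1 + x) * _ / m]mulrAC.
have zm : (1 + x) / m * m = 1 + x by rewrite divfK ?gt_eqF.
have z0 : 0 <= (1 + x) / m by apply: divr_ge0; [exact: addr_ge0|exact: ltW].
have zu2 : (1 + x) / m * (j + 1) ^+ 2 < 1 by rewrite mulrAC ltr_pdivrMr // mul1r.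
move: ((1 + x) / m) zm z0 zu2 => z zm z0 zu2 {l1 pos IH a_ge a a0_ge a0 y}.
have zj0 : 0 <= z * j by rewrite mulr_ge0.
have zu0 : 0 <= z * (j + 1) by rewrite mulr_ge0 ?addr_ge0.
have zJ0 : 0 <= z * j ^+ 2 by rewrite mulr_ge0 ?exprn_ge0.
have zuJ : z * (j + 1) + z * j ^+ 2 <= z * (j + 1) ^+ 2.
  have -> : z * (j + 1) ^+ 2 = z * (j + 1) + z * j ^+ 2 + z * j by ring.
  by rewrite lerDl.
have f1 : (m + j + 1) * (1 - z * (j + 1)) <= m - x * (j + 1).
  have -> : (m + j + 1) * (1 - z * (j + 1)) =
    m + (j + 1) - (z * m) * (j + 1) - (z * (j + 1)) * (j + 1) by ring.
  rewrite zm.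
  have -> : m + (j + 1) - (1 + x) * (j + 1) - z * (j + 1) * (j + 1) =
    m - x * (j + 1) - z * (j + 1) * (j + 1) by ring.
  by rewrite lerBlDr lerDl mulr_ge0 ?addr_ge0.
apply: (@le_trans _ _ ((m + j + 1) * (1 - z * (j + 1)) * (1 - z * j ^+ 2))); last first.
  apply: ler_wpM2r => //; rewrite subr_ge0; apply: le_trans (ltW zu2).
  by apply: le_trans zuJ; rewrite lerDr.
rewrite -mulrA; apply: ler_wpM2l; first by rewrite !addr_ge0 // ltW.
have := mulr_ge0 zu0 zJ0; clear -zuJ; lra.
Qed.

Lemma sqrt_floor c q : (0 < c)%N ->
  exists2 k, (c * k ^ 2 <= q)%N & (q < c * k.+1 ^ 2)%N.
Proof.
move=> c0; have ex : exists k, (c * k ^ 2 <= q)%N by exists 0%N; rewrite muln0.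
have bd k : (c * k ^ 2 <= q)%N -> (k <= q)%N.
  apply: leq_trans; rewrite -mulnn mulnA; case: k => // k.
  by rewrite leq_pmull // muln_gt0 c0.
case: (ex_maxnP ex bd) => k h hmax; exists k => //.
by rewrite ltnNge; apply/negP => /hmax; rewrite ltnn.
Qed.

(** At distance j from the mode, the ratio of consecutive terms is 1 - O(j / q). So of the
    order of sqrt q terms are at least half as large as the largest one, and all terms sum to
    b^q. *)
Lemma bterm_sup (R : rcfType) q i : bterm R q i * Num.sqrt q%:R <= 8 * silver R ^+ q.
Proof.
have bq0 : 0 <= silver R ^+ q by rewrite exprn_ge0 // ltW // silver_gt0.
case: (ltnP q 64) => [q64|q64].
  have s8 : Num.sqrt q%:R <= 8 :> R.
    have -> : 8 = Num.sqrt (8 ^+ 2) :> R by rewrite sqrtr_sqr ger0_norm.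
    by rewrite ler_sqrt ?exprn_ge0 // -natrX ler_nat ltnW.
  by rewrite mulrC ler_pM ?sqrtr_ge0 ?bterm_ge0 // bterm_le.
(* The two inequalities at the mode [M] locate it near q sqrt 2 / b. *)
have [M Mq Mmax] : exists2 M, (M <= q)%N & forall j, bterm R q j <= bterm R q M.
  have [M _ Mmax] := @arg_maxP _ R 'I_q.+1 ord0 xpredT (fun i => bterm R q i) isT.
  exists M; first by rewrite -ltnS.
  move=> j; case: (leqP j q) => jq; last by rewrite bterm_small // bterm_ge0.
  exact: (Mmax (Ordinal (jq : (j < q.+1)%N))).
have /andP[s1 s2] := sqrt2_bounds R; have ss := sqr_sqrt2 R.
have /andP[b1 b2] := silver_bounds R.
have aM := bterm_gt0 R Mq.
have qR : 64 <= q%:R :> R by rewrite ler_nat.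
have MqR : M%:R <= q%:R :> R by rewrite ler_nat.
have M2 : q%:R <= 2 * M%:R :> R.
  have := bterm_next R Mq; have := Mmax M.+1; rewrite -[M.+1%:R]natr1.
  set A := bterm _ _ M.+1; set A0 := bterm _ _ M => le e.
  have : Num.sqrt 2 * (q%:R - M%:R) * A0 <= (M%:R + 1) * A0.
    by rewrite -e ler_wpM2l // addr_ge0.
  by rewrite ler_pM2r //; nra.
have M0 : 0 < M%:R :> R by lra.
have Mlow : M%:R <= Num.sqrt 2 * (q%:R - M%:R + 1) :> R.
  case: M Mq M0 {M2 aM MqR} Mmax => [|m] Mq M0 Mmax; first by rewrite ltxx in M0.
  have := bterm_next R (ltnW Mq); have := Mmax m; have := bterm_gt0 R (ltnW Mq).
  rewrite -[m.+1%:R]natr1; set A := bterm _ _ m.+1; set A0 := bterm _ _ m => A0p le e.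
  have : (m%:R + 1) * A0 <= Num.sqrt 2 * (q%:R - m%:R) * A0.
    by rewrite -e ler_wpM2l // addr_ge0.
  by rewrite ler_pM2r // opprD addrA subrK.
have ratio j : (1 - silver R * j%:R ^+ 2 / M%:R) * bterm R q M <= bterm R q (M + j).
  elim: j => [|j IH]; first by rewrite expr0n /= mulr0 mul0r subr0 mul1r addn0.
  have [neg|pos] := lerP (1 - silver R * j.+1%:R ^+ 2 / M%:R) 0.
    by apply: le_trans (bterm_ge0 _ _ _); rewrite mulr_le0_ge0 // ltW.
  rewrite -[j.+1%:R]natr1 in pos *; have j0 : 0 <= j%:R :> R by [].
  have pos2 : silver R * (j%:R + 1) ^+ 2 < M%:R.
    by move: pos; rewrite subr_gt0 ltr_pdivrMr // mul1r.
  have jM : (M + j <= q)%N.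
    by rewrite -(ler_nat R) natrD; clear -pos2 Mlow M2 s1 s2 b1 b2 j0 qR; nra.
  have e := bterm_next R jM; rewrite [(M + j.+1)%N]addnS.
  have d0 : 0 < (M + j).+1%:R :> R by [].
  rewrite -(ler_pM2l d0) e.
  rewrite -[(M + j).+1%:R]natr1 natrD.
  set A := bterm R q (M + j) in IH *; set A0 := bterm R q M in aM IH *.
  set J := j%:R in j0 pos pos2 IH *; set MM := M%:R in M0 M2 Mlow pos pos2 IH MqR *.
  set x := Num.sqrt 2 in s1 s2 ss Mlow *; set Q := q%:R in qR MqR M2 Mlow *.
  have A00 : 0 <= A by exact: bterm_ge0.
  apply: (@ratio_step _ x) => //; last by clear -Mlow; lra.
  - by apply: ltW; clear -s1; lra.
  - exact: ltW.
have [J J1 J2] := @sqrt_floor 10 q isT.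
have half j : (j <= J)%N -> bterm R q M / 2 <= bterm R q (M + j).
  move=> jJ; apply: le_trans (ratio j); rewrite mulrC ler_pM2r //.
  have : 10 * j%:R ^+ 2 <= q%:R :> R.
    by rewrite -natrX -natrM ler_nat; apply: leq_trans J1; rewrite leq_mul2l leq_sqr.
  move=> h; have : silver R * j%:R ^+ 2 / M%:R <= 1 / 2; last by clear; lra.
  rewrite ler_pdivrMr //.
  apply: (@le_trans _ _ (25 / 10 * j%:R ^+ 2)); first by rewrite ler_wpM2r ?exprn_ge0 // ltW.
  by clear -h M2; lra.
have tot : J.+1%:R * (bterm R q M / 2) <= silver R ^+ q.
  apply: le_trans (bterm_sum_segment R q M J.+1).
  have -> : J.+1%:R * (bterm R q M / 2) = \sum_(i < J.+1) (bterm R q M / 2).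
    by rewrite sumr_const card_ord mulr_natl.
  by apply: ler_sum => k _; apply: half; rewrite -ltnS.
have sJ : Num.sqrt q%:R <= 4 * J.+1%:R :> R.
  have -> : 4 * J.+1%:R = Num.sqrt ((4 * J.+1%:R) ^+ 2) :> R by rewrite sqrtr_sqr ger0_norm
    ?mulr_ge0.
  rewrite ler_sqrt ?exprn_ge0 ?mulr_ge0 //.
  rewrite (_ : (4 * J.+1%:R) ^+ 2 = (16 * J.+1 ^ 2)%:R :> R); last by rewrite natrM natrX; ring.
  rewrite ler_nat.
  apply: leq_trans (ltnW J2) _; rewrite leq_mul2r; exact: orbT.
apply: (@le_trans _ _ (bterm R q M * (4 * J.+1%:R))); last by clear -tot; lra.
by apply: ler_pM; rewrite ?bterm_ge0 ?sqrtr_ge0.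
Qed.

(** * Bounds for the numbers of words, forests and trees *)

Lemma sqrt2_exp2 (R : rcfType) i : (2 ^ i)%:R = Num.sqrt 2 ^+ i * Num.sqrt 2 ^+ i :> R.
Proof. by rewrite -exprMn sqr_sqrt2 natrX. Qed.

Lemma delannoyE (R : rcfType) p q :
  (delannoy p q)%:R = \sum_(i < p.+1) bterm R p i * bterm R q i.
Proof.
rewrite /delannoy natr_sum; apply: eq_bigr => i _.
by rewrite !natrM (sqrt2_exp2 R) /bterm; ring.
Qed.

Lemma delannoy_le (R : rcfType) p q :
  (delannoy p q)%:R * Num.sqrt q%:R <= 8 * silver R ^+ (p + q).
Proof.
rewrite delannoyE mulr_suml exprD -(bterm_sum R p) mulrCA mulr_suml.
apply: ler_sum => i _; rewrite -mulrA ler_wpM2l ?bterm_ge0 //.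
exact: bterm_sup.
Qed.

Lemma size_forests_le (R : rcfType) d r k n : n = (r + k.+2)%N -> (n.*2 <= d)%N ->
  n%:R * Num.sqrt n%:R * (size (forests d k.+1 n))%:R <=
  8 * k.+1%:R * silver R ^+ (r.+1 + n).
Proof.
move=> nE hd; rewrite mulrAC.
have -> : n%:R * (size (forests d k.+1 n))%:R =
    k.+1%:R * (\sum_(i < r.+1) 2 ^ i.+1 * ('C(r, i) * 'C(n, i.+1)))%:R :> R.
  by rewrite -!natrM (size_forests_closed nE hd).
rewrite -[leLHS]mulrA -[leRHS]mulrA [leRHS]mulrCA ler_wpM2l //.
apply: le_trans (delannoy_le R r.+1 n); rewrite ler_wpM2r ?sqrtr_ge0 // ler_nat.
rewrite [delannoy _ _]/delannoy [leqRHS]big_ord_recl; apply: leq_trans (leq_addl _ _).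
apply: leq_sum => i _; rewrite lift0 leq_mul2l leq_mul ?orbT //.
by rewrite binS leq_addl.
Qed.

(** Puts the formula for the number of trees in terms of squares of [bterm n i], to which
    the Cauchy-Schwarz inequality applies. *)
Lemma sum_weighted_squares (R : rcfType) n r : n = (r + 2)%N ->
  \sum_(i < n.+1) i%:R * (n%:R - i%:R) * bterm R n i ^+ 2 =
  n%:R * (n%:R - 1) * (\sum_(i < r.+1) 2 ^ i.+1 * ('C(r, i) * 'C(n, i.+1)))%:R.
Proof.
move=> ->; rewrite addn2.
have -> : r.+2%:R - 1 = r.+1%:R :> R by rewrite -[r.+2%:R]natr1 addrK.
pose F (i : nat) : R := i%:R * (r.+2%:R - i%:R) * bterm R r.+2 i ^+ 2.
have F0 : F 0%N = 0 by rewrite /F !mul0r.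
have Fn : F r.+2 = 0 by rewrite /F subrr mulr0 mul0r.
rewrite natr_sum mulr_sumr -[LHS]/(\sum_(i < r.+3) F i).
rewrite -(big_mkord xpredT F) big_nat_recl // F0 add0r big_nat_recr //= Fn addr0 big_mkord.
apply: eq_bigr => i _; rewrite /F.
have ir : (i <= r)%N by rewrite -ltnS.
have h1 : (r.+2 * 'C(r.+1, i) = i.+1 * 'C(r.+2, i.+1))%N by rewrite mul_bin_diag.
have h2 : (r.+1 * 'C(r, i) = (r.+1 - i) * 'C(r.+1, i))%N by rewrite mul_bin_down.
have h3 : (r.+2 * r.+1 * 'C(r, i) = i.+1 * (r.+1 - i) * 'C(r.+2, i.+1))%N.
  by rewrite -mulnA h2 mulnCA h1 mulnA; congr (_ * _)%N; rewrite mulnC.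
have h3R : r.+2%:R * r.+1%:R * ('C(r, i))%:R =
    i.+1%:R * (r.+2%:R - i.+1%:R) * ('C(r.+2, i.+1))%:R :> R.
  have -> : r.+2%:R - i.+1%:R = (r.+1 - i)%:R :> R by rewrite -subSS natrB // ltnS ltnW.
  by rewrite -!natrM h3.
rewrite !natrM (sqrt2_exp2 R) /bterm.
transitivity (r.+2%:R * r.+1%:R * ('C(r, i))%:R *
  (Num.sqrt (2 : R) ^+ i.+1 * Num.sqrt (2 : R) ^+ i.+1 * ('C(r.+2, i.+1))%:R)); last by ring.
by rewrite h3R; ring.
Qed.

(** The numbers [bterm n i] add up to b^n, and by Chebyshev's inequality half of that comes
    from a window of width of order sqrt n around the mean. By the Cauchy-Schwarz inequality
    their squares add up to at least the order of b^(2 n) / sqrt n. *)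
Lemma size_trees_ge (R : rcfType) d n : (64 <= n)%N -> (n.*2 <= d)%N ->
  silver R ^+ (n + n) <= 192 * (n%:R * Num.sqrt n%:R * (size (forests d 1 n))%:R).
Proof.
move=> n64 hd; have [r nE] : exists r, n = (r + 2)%N by exists (n - 2)%N; lia.
have nR : 64 <= n%:R :> R by rewrite ler_nat.
set q := n%:R in nR *; set w := Num.sqrt q.
have w2 : w * w = q by rewrite -expr2 sqr_sqrtr //; lra.
have w0 : 0 <= w by rewrite sqrtr_ge0.
have w8 : 8 <= w by nra.
have /andP[s1 s2] := sqrt2_bounds R; have /andP[b1 b2] := silver_bounds R.
pose s : R := Num.sqrt 2; rewrite -/s in s1 s2.
pose b := silver R; rewrite -/b in b1 b2 *.
have bs : b = 1 + s by [].
(* The mean is q sqrt 2 / b and the variance is less than q / 4; [dev] is b times the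
   centred variable. *)
pose dev (i : nat) : R := b * i%:R - s * q.
pose W := [pred i : 'I_n.+1 | dev i ^+ 2 <= 4 * q].
pose B := b ^+ n.
have B0 : 0 <= B by rewrite exprn_ge0 //; lra.
(* Chebyshev's inequality: the window carries at least half of the mass. *)
have mass : B / 2 <= \sum_(i | W i) bterm R n i.
  have tot := bterm_sum R n; rewrite -/b -/B in tot.
  have var := bterm_variance R n; rewrite -/q -/s -/b -/B in var.
  rewrite (bigID W) /= in tot.
  set S1 := \sum_(i | W i) _ in tot *; set S2 := \sum_(i | ~~ _) _ in tot.
  have : 4 * q * S2 <= q * s * B.
    rewrite -var mulr_sumr [leRHS](bigID W) /= ler_wpDl //.
      by apply: sumr_ge0 => i _; rewrite mulr_ge0 ?bterm_ge0 ?sqr_ge0.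
    apply: ler_sum => i; rewrite -ltNge => /ltW h.
    by rewrite mulrC ler_wpM2l // bterm_ge0.
  have q0 : 0 < q by lra.
  rewrite [4 * q]mulrC -!mulrA ler_pM2l // => h.
  have : 4 * S2 <= 2 * B by apply: le_trans h _; rewrite ler_wpM2r //; lra.
  by lra.
have card : (#|W|)%:R <= 3 * w.
  case: (pickP W) => [i0 Wi0|W0]; last by rewrite eq_card0 //; lra.
  have [m Wm mmin] := @arg_minnP _ i0 W (fun i => i : nat) Wi0.
  have [K K1 K2] : exists2 K, (K ^ 2 <= n)%N & (n < K.+1 ^ 2)%N.
    by have [K] := @sqrt_floor 1 n isT; rewrite !mul1n; exists K.
  have Kw : K%:R <= w.
    have : K%:R ^+ 2 <= q by rewrite -natrX ler_nat.
    by have : 0 <= K%:R :> R by []; nra.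
  have wK : w < K%:R + 1.
    have : q < (K%:R + 1) ^+ 2 by rewrite natr1 -natrX ltr_nat.
    by have : 0 <= K%:R :> R by []; nra.
  have devw (i : 'I_n.+1) : W i -> - (2 * w) <= dev i <= 2 * w.
    rewrite /= => h; rewrite -ler_norml -(@ler_pXn2r _ 2) ?nnegrE ?mulr_ge0 //.
    rewrite real_normK ?num_real //.
    by have -> : (2 * w) ^+ 2 = 4 * q by rewrite -w2; ring.
  have sub (i : 'I_n.+1) : W i -> (m <= i < m + (K + K + 3))%N.
    move=> Wi; rewrite mmin //=; have /andP[l1 u1] := devw _ Wi; have /andP[l2 u2] := devw _ Wm.
    rewrite -(ltr_nat R) !natrD; rewrite /dev in l1 u1 l2 u2.
    set I : R := (nat_of_ord i)%:R in l1 u1 *; set M : R := (nat_of_ord m)%:R in l2 u2 *.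
    have K0 : 0 <= K%:R :> R by [].
    rewrite ltNge; apply/negP => h.
    have : 24 / 10 * (K%:R + K%:R + 3) <= b * (I - M).
      by apply: ler_pM; clear -K0 h b1; lra.
    by clear -K0 l1 u1 l2 u2 wK; lra.
  apply: (@le_trans _ _ (K + K + 3)%:R); last by rewrite !natrD; clear -Kw w8; lra.
  rewrite ler_nat cardE -(size_map val) -(size_iota m (K + K + 3)).
  apply: uniq_leq_size; first by rewrite map_inj_uniq ?enum_uniq //; exact: val_inj.
  by move=> _ /mapP[i + ->]; rewrite mem_enum mem_iota => /sub.
(* Cauchy-Schwarz on the window, as a sum of the squares (bterm n i - t)^2 for the best t. *)
have squares : B * B <= 12 * w * \sum_(i | W i) bterm R n i ^+ 2.
  pose t := B / (6 * w).
  have tw : t * w = B / 6 by rewrite /t invfM mulrA divfK ?gt_eqF //; lra.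
  have t0 : 0 <= t by rewrite /t divr_ge0 //; lra.
  have : 2 * t * (\sum_(i | W i) bterm R n i) - t ^+ 2 * (#|W|)%:R <= \sum_(i | W i) bterm R n
    i ^+ 2.
    rewrite mulr_natr -sumr_const mulr_sumr -sumrB; apply: ler_sum => i _.
    by have := sqr_ge0 (bterm R n i - t); nra.
  set S := \sum_(i | W i) bterm R n i in mass *; set S2 := \sum_(i | W i) _ ^+ 2 => h.
  have h1 : t * B - t ^+ 2 * (3 * w) <= S2.
    apply: le_trans h; have h2 : t * B <= 2 * t * S by clear -t0 mass; nra.
    have : t ^+ 2 * (#|W|)%:R <= t ^+ 2 * (3 * w) by rewrite ler_wpM2l ?sqr_ge0.
    by clear -h2; lra.
  have h3 : 12 * w * (t * B - t ^+ 2 * (3 * w)) = B * B.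
    have -> : 12 * w * (t * B - t ^+ 2 * (3 * w)) = 12 * (t * w) * B - 36 * (t * w) * (t * w)
      by ring.
    by rewrite tw; field.
  by rewrite -h3 ler_wpM2l //; lra.
pose F (i : nat) : R := i%:R * (q - i%:R) * bterm R n i ^+ 2.
have F0 i : (i <= n)%N -> 0 <= F i.
  by move=> h; apply: mulr_ge0; [apply: mulr_ge0; rewrite // subr_ge0 ler_nat|exact: sqr_ge0].
have low : q * q * \sum_(i | W i) bterm R n i ^+ 2 <= 16 * \sum_(i < n.+1) F i.
  rewrite !mulr_sumr [leRHS](bigID W) /= ler_wpDr //.
    by apply: sumr_ge0 => i _; rewrite mulr_ge0 ?F0 // -ltnS.
  apply: ler_sum => i Wi; rewrite /F [leRHS]mulrA; apply: ler_wpM2r; first exact: sqr_ge0.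
  have : `|dev i| <= q / 4.
    have q4 : 0 <= q / 4 by clear -nR; lra.
    rewrite -(@ler_pXn2r _ 2) ?nnegrE // real_normK ?num_real //; apply: le_trans Wi _.
    have : 0 <= q * (q - 64) by apply: mulr_ge0; clear -nR; lra.
    by clear; lra.
  rewrite ler_norml /dev => /andP[l u]; set I := (nat_of_ord i)%:R in l u *.
  have i1 : q / 4 <= I.
    rewrite leNgt; apply/negP => h; have : b * I <= 25 / 10 * (q / 4).
      by apply: ler_pM; rewrite /I //; clear -b1 b2 h nR; lra.
    have : 1414 / 1000 * q <= s * q by rewrite ler_wpM2r //; clear -s1 nR; lra.
    by clear -l nR; lra.
  have i2 : q / 4 <= q - I.
    rewrite leNgt; apply/negP => h; have : 24 / 10 * (3 / 4 * q) <= b * I.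
      by apply: ler_pM; clear -b1 h nR; lra.
    have : s * q <= 1415 / 1000 * q by rewrite ler_wpM2r //; clear -s2 nR; lra.
    by clear -u nR; lra.
  have q4 : 0 <= q / 4 by clear -nR; lra.
  by have := ler_pM q4 q4 i1 i2; clear; lra.
have closed := @size_forests_closed d r 0 n nE hd.
set f := size _ in closed *.
have FE : \sum_(i < n.+1) F i = q * (q - 1) * (q * f%:R).
  rewrite /q -[n%:R * f%:R]natrM closed mul1n.
  exact: (sum_weighted_squares R nE).
have q0 : 0 < q by clear -nR; lra.
rewrite exprD -/B -(@ler_pM2l _ (q * q)) ?mulr_gt0 //.
rewrite FE in low.
have f0 : 0 <= f%:R :> R by [].
apply: (@le_trans _ _ (12 * w * (16 * (q * (q - 1) * (q * f%:R))))).
  apply: (@le_trans _ _ (q * q * (12 * w * \sum_(i | W i) bterm R n i ^+ 2))).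
    by rewrite ler_wpM2l // mulr_ge0 // ltW.
  by rewrite mulrCA; apply: ler_wpM2l low; rewrite mulr_ge0.
have -> : q * q * (192 * (q * w * f%:R)) = 12 * w * (16 * (q * q * (q * f%:R))) by ring.
have qq0 := ltW q0.
apply: ler_wpM2l; first by rewrite mulr_ge0.
apply: ler_wpM2l => //; apply: ler_wpM2r; first by rewrite mulr_ge0.
by apply: ler_wpM2l => //; clear; lra.
Qed.

(** * Independent letters *)

(** Every [Bin] and [Leaf] has weight 1 / b and every [Unary] has weight 1 / b^2. *)
Definition letter_prob (R : rcfType) (l : letter) : R := (silver R)^-1 ^+ (arity l).+1.

Definition word_prob (R : rcfType) (w : seq letter) : R := \prod_(l <- w) letter_prob R l.

Lemma letter_prob_ge0 (R : rcfType) l : 0 <= letter_prob R l.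
Proof. by rewrite exprn_ge0 // invr_ge0 ltW // silver_gt0. Qed.

Lemma word_prob_ge0 (R : rcfType) w : 0 <= word_prob R w.
Proof. by apply: prodr_ge0 => l _; exact: letter_prob_ge0. Qed.

Lemma word_probE (R : rcfType) w :
  word_prob R w = (silver R)^-1 ^+ (size w + arities w).
Proof.
elim: w => [|l w IH]; first by rewrite /word_prob big_nil.
rewrite /word_prob big_cons -/(word_prob R w) IH -exprD; congr (_ ^+ _).
by rewrite arities_cons /=; lia.
Qed.

(** The weights of [Unary], [Bin] and [Leaf] add up to 1. *)
Lemma silver_inv_root (R : rcfType) :
  (silver R)^-1 + (silver R)^-1 ^+ 2 = 1 - (silver R)^-1.
Proof.
have b0 : silver R != 0 by rewrite gt_eqF // silver_gt0.
have e : silver R ^+ 2 = 2 * silver R + 1.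
  have := sqr_sqrt2 R; rewrite /silver; set s := Num.sqrt 2 => h.
  by transitivity (s * s + 2 * s + 1); [ring|rewrite h; ring].
have h : 1 = 2 * (silver R)^-1 + (silver R)^-1 ^+ 2.
  apply: (mulfI (expf_neq0 2 b0)); rewrite mulr1 {1}e; field; exact: b0.
by rewrite [in RHS]h; ring.
Qed.

Lemma sum_letters (R : rcfType) K (F : letter -> R) :
  \sum_(l <- letters K) F l = \sum_(o <- iota 0 K) (F (o, false) + F (o, true)).
Proof.
rewrite /letters big_allpairs_dep /=; apply: eq_bigr => o _.
by rewrite big_cons big_seq1.
Qed.

Lemma sum_letter_prob (R : rcfType) K :
  \sum_(l <- letters K) letter_prob R l = 1 - (silver R)^-1 ^+ K.
Proof.
rewrite sum_letters; elim: K => [|K IH]; first by rewrite big_nil expr0 subrr.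
rewrite -addn1 iotaD add0n big_cat IH big_seq1.
rewrite /letter_prob /arity /= !addn0 !addn1.
have := silver_inv_root R; set x := (silver R)^-1 => h.
transitivity (1 - x ^+ K + x ^+ K * (x + x ^+ 2)); first by rewrite !exprS; ring.
by rewrite h exprS; ring.
Qed.

Lemma sum_letter_prob_le1 (R : rcfType) K : \sum_(l <- letters K) letter_prob R l <= 1.
Proof. by rewrite sum_letter_prob gerBl exprn_ge0 // invr_ge0 ltW // silver_gt0. Qed.

Definition fan_free_prob (R : rcfType) (K m h : nat) : R :=
  \sum_(w <- words K h) if fan_free m w then word_prob R w else 0.

Lemma sum_word_prob_le1 (R : rcfType) K h : \sum_(w <- words K h) word_prob R w <= 1.
Proof.
elim: h => [|h IH]; first by rewrite big_seq1 /word_prob big_nil.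
rewrite big_words_cons.
under eq_bigr => l _.
  under eq_bigr => w _ do rewrite /word_prob big_cons -/(word_prob R w).
  rewrite -mulr_sumr; over.
rewrite -mulr_suml mulr_ile1 ?sum_letter_prob_le1 //.
  by apply: sumr_ge0 => l _; exact: letter_prob_ge0.
by apply: sumr_ge0 => l _; exact: word_prob_ge0.
Qed.

Lemma fan_free_prob_le1 (R : rcfType) K m h : fan_free_prob R K m h <= 1.
Proof.
apply: le_trans (sum_word_prob_le1 R K h); apply: ler_sum => w _.
by case: ifP => // _; exact: word_prob_ge0.
Qed.

Lemma fan_free_prob_ge0 (R : rcfType) K m h : 0 <= fan_free_prob R K m h.
Proof. by apply: sumr_ge0 => w _; case: ifP => // _; exact: word_prob_ge0. Qed.

Lemma ler_sum_mem (R : rcfType) (T : eqType) (s : seq T) (F : T -> R) x :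
  (forall y, 0 <= F y) -> x \in s -> F x <= \sum_(y <- s) F y.
Proof. by move=> F0 xs; rewrite (big_rem x) //= lerDl sumr_ge0. Qed.

(** The triples [(0, false)], [(i, true)], [(m - i, false)] with [i <= m] all have weight
    b^-(m + 4). *)
Lemma fan_triple_prob (R : rcfType) K m : (m < K)%N ->
  m.+1%:R * (silver R)^-1 ^+ (m + 4) <=
  \sum_(l0 <- letters K) \sum_(l1 <- letters K) \sum_(l2 <- letters K)
     if fan_triple m l0 l1 l2 then letter_prob R l0 * letter_prob R l1 * letter_prob R l2
     else 0.
Proof.
move=> mK; pose p := letter_prob R.
pose F l0 l1 l2 : R := if fan_triple m l0 l1 l2 then p l0 * p l1 * p l2 else 0.
have F0 l0 l1 l2 : 0 <= F l0 l1 l2.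
  by rewrite /F; case: ifP => // _; rewrite !mulr_ge0 ?letter_prob_ge0.
have S0 l0 l1 : 0 <= \sum_(l2 <- letters K) F l0 l1 l2 by rewrite sumr_ge0.
apply: le_trans (@ler_sum_mem R _ (letters K)
   (fun l0 => \sum_(l1 <- letters K) \sum_(l2 <- letters K) F l0 l1 l2) (0%N, false) _ _).
- rewrite [leRHS]sum_letters.
  apply: (@le_trans _ _ (\sum_(o <- iota 0 m.+1) (silver R)^-1 ^+ (m + 4))).
    by rewrite big_const_seq count_predT size_iota iter_addr_0 mulr_natl.
  have -> : iota 0 K = iota 0 m.+1 ++ iota m.+1 (K - m.+1) by rewrite -{1}(subnKC mK) iotaD.
  rewrite big_cat [leRHS]/=; apply: ler_wpDr.
    by apply: sumr_ge0 => o _; apply: addr_ge0; exact: S0.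
  rewrite !big_seq; apply: ler_sum => o; rewrite mem_iota add0n ltnS => /= om.
  apply: ler_wpDl => //.
  have mem : (m - o, false)%N \in letters K by rewrite mem_letters /= (leq_ltn_trans (leq_subr
    _ _)).
  apply: le_trans (@ler_sum_mem R _ (letters K) (F (0%N, false) (o, true)) _ (F0 _ _) mem).
  rewrite /F /p /fan_triple /= subnKC // leqnn /letter_prob /arity /= -!exprD.
  have e : ((0 + 0).+1 + (o + 1).+1 + (m - o + 0).+1 = m + 4)%N by lia.
  by rewrite e.
- by move=> l0; apply: sumr_ge0.
- by rewrite mem_letters /=; apply: leq_ltn_trans mK.
Qed.

Lemma fan_free_prob_step (R : rcfType) K m h : (m < K)%N ->
  fan_free_prob R K m h.+3 <=
  (1 - m.+1%:R * (silver R)^-1 ^+ (m + 4)) * fan_free_prob R K m h.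
Proof.
move=> mK; pose p := letter_prob R.
have -> : fan_free_prob R K m h.+3 =
    (\sum_(l0 <- letters K) \sum_(l1 <- letters K) \sum_(l2 <- letters K)
     if fan_triple m l0 l1 l2 then 0 else p l0 * p l1 * p l2) * fan_free_prob R K m h.
  rewrite /fan_free_prob big_words_cons mulr_suml; apply: eq_bigr => l0 _.
  rewrite big_words_cons mulr_suml; apply: eq_bigr => l1 _.
  rewrite big_words_cons mulr_suml; apply: eq_bigr => l2 _.
  rewrite mulr_sumr; apply: eq_bigr => w _ /=.
  case: (fan_triple m l0 l1 l2) => /=; first by rewrite mul0r.
  by case: (fan_free m w); rewrite ?mulr0 // /word_prob !big_cons !mulrA.
apply: ler_wpM2r; first exact: fan_free_prob_ge0.
rewrite lerBrDr; apply: le_trans (lerD (lexx _) (fan_triple_prob R mK)) _.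
rewrite -big_split /=.
apply: (@le_trans _ _ (\sum_(l0 <- letters K) p l0)); last exact: sum_letter_prob_le1.
have tot x : 0 <= x -> x * (\sum_(l <- letters K) p l) <= x.
  by move=> x0; rewrite ler_piMr // sum_letter_prob_le1.
apply: ler_sum => l0 _; rewrite -big_split /=.
have p0 l : 0 <= p l := letter_prob_ge0 R l.
apply: le_trans (tot _ (p0 l0)); rewrite mulr_sumr; apply: ler_sum => l1 _; rewrite -big_split /=.
have p1 := mulr_ge0 (p0 l0) (p0 l1).
apply: le_trans (tot _ p1); rewrite mulr_sumr; apply: ler_sum => l2 _.
by case: ifP; rewrite ?add0r ?addr0.
Qed.

Lemma exp_inv_linear (R : rcfType) (q : R) j : 0 <= q <= 1 -> (1 - q) ^+ j * (1 + j%:R * q) <= 1.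
Proof.
move=> /andP[q0 q1]; elim: j => [|j IH]; first by rewrite mul0r addr0 mulr1.
apply: le_trans IH; rewrite exprSr -mulrA ler_wpM2l ?exprn_ge0 ?subr_ge0 //.
rewrite -natr1; have j0 : 0 <= j%:R :> R by [].
have -> : (1 - q) * (1 + (j%:R + 1) * q) = 1 + j%:R * q - (j%:R + 1) * (q * q) by ring.
by rewrite gerBl !mulr_ge0 ?addr_ge0.
Qed.

Lemma fan_free_prob_le (R : rcfType) K m j h : (m < K)%N -> (3 * j <= h)%N ->
  fan_free_prob R K m h * (j%:R * (m.+1%:R * (silver R)^-1 ^+ (m + 4))) <= 1.
Proof.
move=> mK jh; set q := m.+1%:R * _.
have x0 : 0 <= (silver R)^-1 by rewrite invr_ge0 ltW // silver_gt0.
have q0 : 0 <= q by rewrite mulr_ge0 // exprn_ge0.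
have q1 : q <= 1.
  have := @fan_free_prob_step R K m 0 mK; rewrite -/q.
  rewrite {2}/fan_free_prob big_seq1 /word_prob big_nil mulr1 => h1.
  have := le_trans (fan_free_prob_ge0 R K m 3) h1; by rewrite subr_ge0.
have step : fan_free_prob R K m h <= (1 - q) ^+ j.
  elim: j h jh => [|j IH] h jh; first exact: fan_free_prob_le1.
  case: h jh => [|[|[|h]]] jh; try lia.
  apply: le_trans (fan_free_prob_step R h mK) _; rewrite exprS ler_wpM2l ?subr_ge0 //.
  by apply: IH; lia.
apply: le_trans (@exp_inv_linear R q j _); last by rewrite q0.
by apply: ler_pM => //; [exact: fan_free_prob_ge0 | exact: mulr_ge0 | rewrite lerDr].
Qed.

(** The number of completions of [u] to a given sum depends on [u] essentially through the
    factor b^(- arities u): conditioning on the sum costs a constant factor only. *)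
Lemma sum_words_pair_le (R : rcfType) K n k (us : seq (seq letter)) (P : pred (seq letter)) :
  Num.sqrt k%:R * \sum_(u <- us) (\sum_(v <- words K k)
     (if ((arities u + arities v).+1 == n) && P u then 1 else 0)) <=
  8 * silver R ^+ (n + k) * \sum_(u <- us) (if P u then (silver R)^-1 ^+ (arities u) else 0).
Proof.
have b0 := silver_gt0 R; have b1 : 1 <= silver R by have /andP[] := silver_bounds R; lra.
rewrite !mulr_sumr; apply: ler_sum => u _.
case: (P u); last by rewrite mulr0 big1 ?mulr0 // => v _; rewrite andbF.
have [un|un] := leqP n (arities u).
  rewrite big1 ?mulr0; first by rewrite !mulr_ge0 ?exprn_ge0 ?invr_ge0 // ltW.
  by move=> v _; case: eqP => //; lia.
have -> : \sum_(v <- words K k) (if ((arities u + arities v).+1 == n) && true then 1 else 0) =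
    (count (fun v => arities v == n - (arities u).+1)%N (words K k))%:R :> R.
  rewrite -sum1_count natr_sum [RHS]big_mkcond; apply: eq_bigr => v _; rewrite andbT.
  by have -> : ((arities u + arities v).+1 == n) = (arities v == n - (arities u).+1)%N by
    apply/eqP/eqP; lia.
apply: (@le_trans _ _ (Num.sqrt k%:R * (delannoy (n - (arities u).+1) k)%:R)).
  by rewrite ler_wpM2l ?sqrtr_ge0 // ler_nat count_words_arities.
rewrite mulrC; apply: le_trans (delannoy_le R _ _) _.
rewrite -mulrA ler_wpM2l // exprVn ler_pdivlMr ?exprn_gt0 // -exprD ler_weXn2l //.
lia.
Qed.

Lemma size_words K n w : w \in words K n -> size w = n.
Proof. by rewrite mem_words => /andP[/eqP]. Qed.

Lemma fan_free_words_le (R : rcfType) K n h m : (h <= n)%N ->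
  Num.sqrt (n - h)%:R *
    (count (fun w => ((arities w).+1 == n) && fan_free m (take h w)) (words K n))%:R <=
    8 * silver R ^+ (n + n) * fan_free_prob R K m h /\
  Num.sqrt h%:R *
    (count (fun w => ((arities w).+1 == n) && fan_free m (drop h w)) (words K n))%:R <=
    8 * silver R ^+ (n + n) * fan_free_prob R K m (n - h).
Proof.
move=> hn; have b0 := silver_gt0 R.
have prob k l : (l + k = n)%N -> silver R ^+ (n + l) *
   \sum_(u <- words K k) (if fan_free m u then (silver R)^-1 ^+ (arities u) else 0) =
    silver R ^+ (n + n) * fan_free_prob R K m k.
  move=> e; rewrite -{3}e addnA [in RHS]exprD -[in RHS]mulrA; congr (_ * _).
  rewrite /fan_free_prob mulr_sumr !big_seq.
  apply: eq_bigr => u /size_words su; case: ifP => _; last by rewrite mulr0.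
  rewrite word_probE su exprD exprVn [(silver R)^-1 ^+ k]exprVn mulrA mulfV ?mul1r //.
  by rewrite expf_neq0 // gt_eqF.
have cnt (P : pred (seq letter)) : (count P (words K n))%:R =
    \sum_(u <- words K h) \sum_(v <- words K (n - h)) (if P (u ++ v) then 1 else 0) :> R.
  rewrite -sum1_count natr_sum big_mkcond /= -{1}(subnKC hn).
  exact: (big_words_cat _ K h (n - h) (fun w => if P w then 1 else 0)).
split.
- have := @sum_words_pair_le R K n (n - h) (words K h) (fan_free m).
  rewrite -[8 * _ * _]mulrA prob ?subnK // mulrA; apply: le_trans.
  rewrite cnt ler_wpM2l ?sqrtr_ge0 // le_eqVlt; apply/orP; left; apply/eqP.
  rewrite !big_seq; apply: eq_bigr => u /size_words su; apply: eq_bigr => v _.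
  by rewrite arities_cat take_size_cat.
- have := @sum_words_pair_le R K n h (words K (n - h)) (fan_free m).
  rewrite -[8 * _ * _]mulrA prob ?subnKC // mulrA; apply: le_trans.
  rewrite cnt ler_wpM2l ?sqrtr_ge0 // exchange_big /= le_eqVlt; apply/orP; left; apply/eqP.
  apply: eq_bigr => v _; rewrite !big_seq; apply: eq_bigr => u /size_words su.
  by rewrite arities_cat addnC drop_size_cat.
Qed.

(** Both halves of a word contain [n %/ 6] disjoint triples, and a half is completed by at least
    [n / 4] letters, which accounts for the factor sqrt n. *)
Lemma avoiding_trees_le (R : rcfType) n m (s : seq tree) : (12 <= n)%N -> (m < n)%N ->
  uniq s -> {in s, forall t, weight t = n /\ ~~ fan_seen m true (code t)} ->
  n%:R * Num.sqrt n%:R * (size s)%:R * (n%:R * m.+1%:R) <=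
  384 * silver R ^+ (n + n) * silver R ^+ (m + 4).
Proof.
move=> n12 mn us hs; pose j := (n %/ 6)%N; pose h := (3 * j)%N.
have hn : (h <= n)%N by rewrite /h /j; lia.
have [h4 nh4 jn] : [/\ n <= 4 * h, n <= 4 * (n - h) & n <= 12 * j]%N by rewrite /h /j; split; lia.
have h3 : (3 * j <= n - h)%N by rewrite /h /j; lia.
have := @avoiding_trees_bound m n h s (ltac:(lia)) hn us hs.
set c1 := count _ _; set c2 := count _ _ => cc.
have [h1 h2] := @fan_free_words_le R n n h m hn; rewrite -/c1 -/c2 in h1 h2.
have p1 := @fan_free_prob_le R n m j h mn (leqnn _).
have p2 := @fan_free_prob_le R n m j (n - h) mn h3.
have b0 := silver_gt0 R.
set B := silver R ^+ (n + n) in h1 h2 *; have B0 : 0 < B by rewrite exprn_gt0.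
set q := m.+1%:R * _ in p1 p2.
have half k : (n <= 4 * k)%N -> Num.sqrt n%:R <= 2 * Num.sqrt k%:R :> R.
  move=> nk; have -> : 2 = Num.sqrt (2 ^+ 2) :> R by rewrite sqrtr_sqr ger0_norm.
  by rewrite -sqrtrM ?exprn_ge0 // ler_sqrt ?mulr_ge0 ?exprn_ge0 // -natrX -natrM ler_nat.
set w := Num.sqrt n%:R in half *; have w0 : 0 <= w by rewrite sqrtr_ge0.
have q0 : 0 <= j%:R * q by rewrite !mulr_ge0 ?exprn_ge0 ?invr_ge0 // ltW.
have key k c P : (n <= 4 * k)%N -> Num.sqrt k%:R * c%:R <= 8 * B * P -> P * (j%:R * q) <= 1 ->
    w * c%:R * (j%:R * q) <= 16 * B.
  move=> nk hc hP; apply: (@le_trans _ _ (2 * (Num.sqrt k%:R * c%:R) * (j%:R * q))).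
    by rewrite ler_wpM2r // mulrA ler_wpM2r // half.
  apply: (@le_trans _ _ (2 * (8 * B * P) * (j%:R * q))).
    by rewrite ler_wpM2r // ler_wpM2l.
  have -> : 2 * (8 * B * P) * (j%:R * q) = 16 * B * (P * (j%:R * q)) by ring.
  by rewrite ler_piMr // mulr_ge0 // ltW.
have k1 := key _ _ _ nh4 h1 p1; have k2 := key _ _ _ h4 h2 p2.
have ccR : n%:R * (size s)%:R <= c1%:R + c2%:R :> R by rewrite -natrM -natrD ler_nat.
have main : w * (n%:R * (size s)%:R) * (j%:R * q) <= 32 * B.
  apply: (@le_trans _ _ (w * (c1%:R + c2%:R) * (j%:R * q))).
    by rewrite ler_wpM2r // ler_wpM2l.
  by rewrite mulrDr mulrDl; clear -k1 k2; lra.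
have jR : n%:R <= 12 * j%:R :> R by rewrite -natrM ler_nat.
have qE : m.+1%:R = q * silver R ^+ (m + 4).
  by rewrite /q exprVn -mulrA mulVf ?mulr1 // expf_neq0 // gt_eqF.
rewrite qE; set b4 := silver R ^+ (m + 4).
have b40 : 0 <= b4 by rewrite exprn_ge0 // ltW.
have qq : 0 <= q by rewrite !mulr_ge0 ?exprn_ge0 ?invr_ge0 // ltW.
have -> : n%:R * w * (size s)%:R * (n%:R * (q * b4)) = (w * (n%:R * (size s)%:R) * (n%:R * q))
  * b4 by ring.
apply: ler_wpM2r => //.
apply: (@le_trans _ _ (w * (n%:R * (size s)%:R) * (12 * (j%:R * q)))).
  by apply: ler_wpM2l; rewrite ?mulr_ge0 // mulrA ler_wpM2r.
have -> : w * (n%:R * (size s)%:R) * (12 * (j%:R * q)) = 12 * (w * (n%:R * (size s)%:R) * (j%:R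
  * q)) by ring.
by clear -main; lra.
Qed.

Local Open Scope classical_set_scope.
Local Open Scope ring_scope.

(** * Convex position of the roots of unity *)

(** Twice the signed area of the triangle with vertices [a], [b] and [c]. *)
Definition orient (R : realType) (a b c : plane R) : R :=
  (b.1 - a.1) * (c.2 - a.2) - (b.2 - a.2) * (c.1 - a.1).

Lemma orient_cycle (R : realType) (a b c : plane R) : orient a b c = orient b c a.
Proof. by rewrite /orient; ring. Qed.

Lemma orient_swap (R : realType) (a b c : plane R) : orient a c b = - orient a b c.
Proof. by rewrite /orient; ring. Qed.

Lemma orient_degenerate (R : realType) (a b : plane R) : orient a b a = 0 /\ orient a b b = 0.
Proof. by split; rewrite /orient; ring. Qed.

Lemma orient_circle (R : realType) (a x y : R) :
  let pt t : plane R := (cos t, sin t) in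
  orient (pt a) (pt (a + (x + x))) (pt (a + (x + x) + (y + y))) =
  4 * sin x * sin y * sin (x + y).
Proof.
move=> pt; set b := a + (x + x); set c := b + (y + y).
have -> : orient (pt a) (pt b) (pt c) = sin (b - a) + sin (c - b) - sin (c - a).
  by rewrite /orient /pt /= !sinB; ring.
have -> : b - a = x + x by rewrite /b addrC addKr.
have -> : c - b = y + y by rewrite /c addrC addKr.
have -> : c - a = (x + y) + (x + y) by rewrite /c /b; ring.
rewrite !(sinD (x + y)) !sinD !cosD.
have hx := cos2Dsin2 x; have hy := cos2Dsin2 y; rewrite !expr2 in hx hy.
move: (cos x) (sin x) (cos y) (sin y) hx hy => cx sx cy sy hx hy.
have ex : sx * sx = 1 - cx * cx by rewrite -hx; ring.
have ey : sy * sy = 1 - cy * cy by rewrite -hy; ring.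
transitivity (2 * sx * cx * (cy * cy + sy * sy) + 2 * sy * cy * (cx * cx + sx * sx)
   - 2 * (sx * cy + cx * sy) * (cx * cy - sx * sy)); last by ring.
by rewrite hx hy; ring.
Qed.

Lemma orient_vertex_gt0 (R : realType) n (i j k : 'I_n) : (i < j < k)%N ->
  0 < orient (vertex R i) (vertex R j) (vertex R k).
Proof.
move=> /andP[ij jk]; have n0 : 0 < n%:R :> R by rewrite ltr0n (leq_ltn_trans _ (ltn_ord i)).
have p0 := pi_gt0 R.
pose th (l : 'I_n) : R := 2 * pi * l%:R / n%:R.
pose x := pi * (j%:R - i%:R) / n%:R : R; pose y := pi * (k%:R - j%:R) / n%:R : R.
have ej : th j = th i + (x + x) by rewrite /th /x; ring.
have ek : th k = th i + (x + x) + (y + y) by rewrite /th /x /y; ring.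
have -> : orient (vertex R i) (vertex R j) (vertex R k) = 4 * sin x * sin y * sin (x + y).
  by rewrite -(orient_circle (th i)) -ej [in RHS](_ : th j + (y + y) = th k) // ej ek.
have ijR : 0 < j%:R - i%:R :> R by rewrite subr_gt0 ltr_nat.
have jkR : 0 < k%:R - j%:R :> R by rewrite subr_gt0 ltr_nat.
have x0 : 0 < x by rewrite /x divr_gt0 // mulr_gt0.
have y0 : 0 < y by rewrite /y divr_gt0 // mulr_gt0.
have xy : x + y < pi.
  have -> : x + y = pi * ((k%:R - i%:R) / n%:R) by rewrite /x /y; ring.
  rewrite gtr_pMr // ltr_pdivrMr // mul1r.
  have : k%:R < n%:R :> R by rewrite ltr_nat.
  by apply: le_lt_trans; rewrite gerBl.
rewrite !mulr_gt0 //; apply: sin_gt0_pi; apply/andP; split => //.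
- by apply: lt_trans xy; rewrite ltrDl.
- by apply: lt_trans xy; rewrite ltrDr.
- exact: addr_gt0.
Qed.

Definition side_of (R : realType) n (p : 'I_n * 'I_n) (k : 'I_n) : R :=
  orient (vertex R p.1) (vertex R p.2) (vertex R k).

Lemma side_of_out (R : realType) n (p : 'I_n * 'I_n) (k : 'I_n) :
  (p.1 < p.2)%N -> (k < p.1)%N || (p.2 < k)%N -> 0 < side_of R p k.
Proof.
move=> pp /orP[kp|pk]; rewrite /side_of; last by apply: orient_vertex_gt0; rewrite pp.
by rewrite -orient_cycle; apply: orient_vertex_gt0; rewrite kp.
Qed.

Lemma side_of_in (R : realType) n (p : 'I_n * 'I_n) (k : 'I_n) :
  (p.1 < k < p.2)%N -> side_of R p k < 0.
Proof. by move=> pk; rewrite /side_of orient_swap oppr_lt0; apply: orient_vertex_gt0. Qed.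

Lemma side_of_eq0 (R : realType) n (p : 'I_n * 'I_n) (k : 'I_n) : (p.1 < p.2)%N ->
  side_of R p k = 0 -> k = p.1 \/ k = p.2.
Proof.
move=> pp h; case: (ltngtP k p.1) => [kp|pk|/val_inj]; last by left.
  by have := @side_of_out R n p k pp; rewrite h kp ltxx => /(_ isT).
case: (ltngtP k p.2) => [kp|pk'|/val_inj]; last by right.
  by have := @side_of_in R n p k; rewrite h pk kp ltxx => /(_ isT).
by have := @side_of_out R n p k pp; rewrite h pk' ltxx orbT => /(_ isT).
Qed.

Lemma side_of_ends (R : realType) n (p : 'I_n * 'I_n) :
  side_of R p p.1 = 0 /\ side_of R p p.2 = 0.
Proof. exact: orient_degenerate. Qed.

Lemma chord_orient (R : realType) n (p : 'I_n * 'I_n) z : @chord R n p z ->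
  orient (vertex R p.1) (vertex R p.2) z = 0.
Proof. by case=> t _ ->; rewrite /orient /=; ring. Qed.

Definition on_chord (R : realType) n (q : 'I_n * 'I_n) (t : R) : plane R :=
  ((1 - t) * (vertex R q.1).1 + t * (vertex R q.2).1,
   (1 - t) * (vertex R q.1).2 + t * (vertex R q.2).2).

Lemma on_chord0 (R : realType) n (q : 'I_n * 'I_n) : on_chord q 0 = vertex R q.1.
Proof. by rewrite /on_chord subr0 !mul1r !mul0r !addr0 -surjective_pairing. Qed.

Lemma on_chord1 (R : realType) n (q : 'I_n * 'I_n) : on_chord q 1 = vertex R q.2.
Proof. by rewrite /on_chord subrr !mul1r !mul0r !add0r -surjective_pairing. Qed.

Lemma chord_end1 (R : realType) n (q : 'I_n * 'I_n) : @chord R n q (vertex R q.1).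
Proof. by exists 0; rewrite ?lexx ?ler01 // -[RHS]/(on_chord q 0) on_chord0. Qed.

Lemma chord_end2 (R : realType) n (q : 'I_n * 'I_n) : @chord R n q (vertex R q.2).
Proof. by exists 1; rewrite ?lexx ?ler01 // -[RHS]/(on_chord q 1) on_chord1. Qed.

Lemma orient_on_chord (R : realType) n (p q : 'I_n * 'I_n) (t : R) :
  orient (vertex R p.1) (vertex R p.2) (on_chord q t) =
  (1 - t) * side_of R p q.1 + t * side_of R p q.2.
Proof. by rewrite /side_of /orient /=; ring. Qed.

Lemma chord_vertex (R : realType) n (p : 'I_n * 'I_n) (k : 'I_n) : (p.1 < p.2)%N ->
  @chord R n p (vertex R k) -> k = p.1 \/ k = p.2.
Proof. by move=> pp /chord_orient; exact: side_of_eq0. Qed.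

Lemma vertex_inj (R : realType) n : (2 < n)%N -> injective (@vertex R n).
Proof.
move=> n2 i j e; apply/eqP; apply: contraT => ne.
have [k [ki kj]] : exists k : 'I_n, k != i /\ k != j.
  pose A := [set x : 'I_n | (x != i) && (x != j)]%SET.
  have : A != finset.set0.
    rewrite -card_gt0; have : (#|~: A| <= 2)%N.
      have -> : ~: A = [set i; j]%SET by apply/setP => x; rewrite !inE negb_and !negbK.
      by rewrite cards2; case: (_ != _).
    by have := cardsC A; rewrite card_ord; lia.
  by case/finset.set0Pn => k; rewrite inE => /andP[? ?]; exists k.
wlog ij : i j e ne ki kj / (i < j)%N.
  move=> H; case: (ltngtP i j) => [|ji|/val_inj ij]; first exact: H.
    by apply: (H j i) => //; rewrite eq_sym.
  by rewrite ij eqxx in ne.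
have : side_of R (i, j) k = 0 by rewrite /side_of /= e; rewrite /orient; ring.
by move/(@side_of_eq0 R n (i, j) k ij) => -[] /= ek; rewrite ek eqxx in ki kj.
Qed.

Lemma eq_pair_ends n (p q : 'I_n * 'I_n) : (p.1 < p.2)%N -> (q.1 < q.2)%N ->
  q.1 = p.1 \/ q.1 = p.2 -> q.2 = p.1 \/ q.2 = p.2 -> p = q.
Proof.
case: p q => [a b] [c d] /= ab + [e1|e1] [e2|e2]; rewrite e1 e2 // ?ltnn //.
by move=> ba; have := ltn_trans ab ba; rewrite ltnn.
Qed.

(** Along [q], the signed distance to the line of [p] is affine and does not vanish at both ends. *)
Lemma chords_meet_once (R : realType) n (p q : 'I_n * 'I_n) :
  (p.1 < p.2)%N -> (q.1 < q.2)%N -> p != q ->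
  @chord R n p `&` @chord R n q `<=`
    [set on_chord q (side_of R p q.1 / (side_of R p q.1 - side_of R p q.2))].
Proof.
move=> pp qq pq z [/chord_orient + [t _]]; rewrite -/(on_chord q t) => + zt /=.
rewrite zt orient_on_chord; set h1 := side_of _ _ _; set h2 := side_of _ _ _ => h.
have [e|ne] := eqVneq h1 h2; last first.
  congr on_chord; have d0 : h1 - h2 != 0 by rewrite subr_eq0.
  have e2 : t * (h1 - h2) = h1 by rewrite -[RHS]subr0 -h; ring.
  by rewrite -{1}e2 mulfK.
have h10 : h1 = 0 by rewrite -h -e; ring.
have h20 : h2 = 0 by rewrite -e.
by move/eqP: pq; case; apply: eq_pair_ends => //; [exact: side_of_eq0 h10|exact: side_of_eq0 h20].
Qed.

(** Unless an endpoint is shared, the endpoints of [q] lie strictly on the same side of the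
    line of [p]. *)
Lemma noncrossing_chords (R : realType) n (p q : 'I_n * 'I_n) :
  (p.1 < p.2)%N -> (q.1 < q.2)%N -> p != q ->
  ~~ cross (pair_val p) (pair_val q) -> ~~ cross (pair_val q) (pair_val p) ->
  @chord R n p `&` @chord R n q `<=` @endpoints R n p `&` @endpoints R n q.
Proof.
move=> pp qq pq c1 c2 z [/chord_orient + [t /andP[t0 t1]]]; rewrite -/(on_chord q t) => + zt.
rewrite zt orient_on_chord => h.
have shared1 : q.1 = p.1 \/ q.1 = p.2 -> @endpoints R n p (vertex R q.1).
  by case=> ->; [left|right].
have shared2 : q.2 = p.1 \/ q.2 = p.2 -> @endpoints R n p (vertex R q.2).
  by case=> ->; [left|right].
have [h1|h1] := eqVneq (side_of R p q.1) 0.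
  have e1 := side_of_eq0 pp h1.
  have h2 : side_of R p q.2 != 0.
    by apply/eqP => h2; move/eqP: pq; apply; apply: eq_pair_ends => //; exact: side_of_eq0 h2.
  move: h; rewrite h1 mulr0 add0r => /eqP; rewrite mulf_eq0 (negPf h2) orbF => /eqP ->.
  by rewrite on_chord0; split; [exact: shared1|left].
have [h2|h2] := eqVneq (side_of R p q.2) 0.
  have e2 := side_of_eq0 pp h2.
  move: h; rewrite h2 mulr0 addr0 => /eqP; rewrite mulf_eq0 (negPf h1) orbF subr_eq0 => /eqP <-.
  by rewrite on_chord1; split; [exact: shared2|right].
have n1 : q.1 != p.1 by apply: contra_neq h1 => ->; case: (side_of_ends R p).
have n2 : q.1 != p.2 by apply: contra_neq h1 => ->; case: (side_of_ends R p).
have n3 : q.2 != p.1 by apply: contra_neq h2 => ->; case: (side_of_ends R p).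
have n4 : q.2 != p.2 by apply: contra_neq h2 => ->; case: (side_of_ends R p).
rewrite -!val_eqE /= in n1 n2 n3 n4; rewrite /cross /pair_val /= in c1 c2.
exfalso; have [in1|out1] := boolP (p.1 < q.1 < p.2)%N.
  have l1 := side_of_in R in1.
  have [in2|out2] := boolP (p.1 < q.2 < p.2)%N; last by exfalso; lia.
  have l2 := side_of_in R in2.
  have [t10|t10] := eqVneq t 0; first by move: h; rewrite t10 subr0 mul1r mul0r addr0 => h;
    rewrite h eqxx in h1.
  have tp : 0 < t by rewrite lt_neqAle eq_sym t10.
  by move: h l1 l2 t1 tp; clear; nra.
have l1 : 0 < side_of R p q.1 by apply: side_of_out => //; lia.
have [in2|out2] := boolP (p.1 < q.2 < p.2)%N; first by exfalso; lia.
have l2 : 0 < side_of R p q.2 by apply: side_of_out => //; lia.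
have [t10|t10] := eqVneq t 0; first by move: h; rewrite t10 subr0 mul1r mul0r addr0 => h;
  rewrite h eqxx in h1.
have tp : 0 < t by rewrite lt_neqAle eq_sym t10.
by move: h l1 l2 t1 tp; clear; nra.
Qed.

(** The meeting point is a barycentre of the endpoints of [p], and also of those of [q]; the
    weight of each endpoint is the area of the triangle formed by the three others. *)
Lemma crossing_chords_meet (R : realType) n (p q : 'I_n * 'I_n) :
  cross (pair_val p) (pair_val q) -> exists z, @chord R n p z /\ @chord R n q z.
Proof.
rewrite /cross /pair_val /= => /andP[h1 /andP[h2 h3]].
pose a := vertex R p.1; pose b := vertex R p.2; pose c := vertex R q.1; pose d := vertex R q.2.
pose wa := orient c b d; pose wb := orient a c d; pose wc := orient a b d;
  pose wd := orient a c b.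
have wa0 : 0 < wa by apply: orient_vertex_gt0; rewrite h2.
have wb0 : 0 < wb by apply: orient_vertex_gt0; rewrite h1 (ltn_trans h2).
have wc0 : 0 < wc by apply: orient_vertex_gt0; rewrite h3 (ltn_trans h1).
have wd0 : 0 < wd by apply: orient_vertex_gt0; rewrite h1.
have s : wa + wb = wc + wd by rewrite /wa /wb /wc /wd /orient; ring.
have e1 : wa * a.1 + wb * b.1 = wc * c.1 + wd * d.1 by rewrite /wa /wb /wc /wd /orient; ring.
have e2 : wa * a.2 + wb * b.2 = wc * c.2 + wd * d.2 by rewrite /wa /wb /wc /wd /orient; ring.
have s1 : 0 < wa + wb by rewrite addr_gt0.
have s2 : 0 < wc + wd by rewrite addr_gt0.
have u (x y : R) : 0 < x -> 0 < y -> 0 <= y / (x + y) <= 1.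
  move=> x0 y0; have xy := addr_gt0 x0 y0; apply/andP; split.
    by apply: divr_ge0; exact: ltW.
  by rewrite ler_pdivrMr // mul1r lerDr ltW.
have v (x y f g : R) : 0 < x -> 0 < y ->
    (1 - y / (x + y)) * f + y / (x + y) * g = (x * f + y * g) / (x + y).
  by move=> x0 y0; field; rewrite gt_eqF // addr_gt0.
exists ((wa * a.1 + wb * b.1) / (wa + wb), (wa * a.2 + wb * b.2) / (wa + wb)); split.
  by exists (wb / (wa + wb)); [exact: u|rewrite !v].
by exists (wd / (wc + wd)); [exact: u|rewrite !v // e1 e2 s].
Qed.

Lemma crossing_chords (R : realType) n (p q : 'I_n * 'I_n) : (2 < n)%N ->
  @chord R n p `&` @chord R n q `<=` @endpoints R n p `&` @endpoints R n q ->
  ~~ cross (pair_val p) (pair_val q).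
Proof.
move=> n2 sub; apply/negP => c; have [z [zp zq]] := crossing_chords_meet R c.
have [] := sub z (conj zp zq); move: c; rewrite /cross /pair_val /= => c.
have ne (i j : 'I_n) : (i != j :> nat) -> vertex R i <> vertex R j.
  by move=> ij /(vertex_inj n2) e; rewrite e eqxx in ij.
by move=> [] -> [] /ne; apply; lia.
Qed.

(** * Dissections as plane sets *)

Definition shape (R : realType) n (D : {set 'I_n * 'I_n}) : set (plane R) :=
  (\bigcup_(p in [set p | is_side p]) @chord R n p) `|`
  (\bigcup_(p in [set p | p \in D]) @chord R n p).

Lemma chord_infinite (R : realType) n (p : 'I_n * 'I_n) : (2 < n)%N -> (p.1 < p.2)%N ->
  ~ finite_set (@chord R n p).
Proof.
move=> n2 pp fin; apply: infinite_nat.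
pose t (k : nat) : R := k.+1%:R^-1.
have tin k : 0 <= t k <= 1.
  by rewrite invr_ge0 ler0n /= invf_le1 ?ler1n ?ltr0n.
have tinj : injective t by move=> k l /invr_inj /eqP; rewrite eqr_nat => /eqP [].
have ne : vertex R p.1 != vertex R p.2.
  by apply/eqP => /(vertex_inj n2) e; rewrite e ltnn in pp.
have inj : injective (fun k => @on_chord R n p (t k)).
  move=> k l [e1 e2]; apply: tinj; apply/eqP; rewrite -subr_eq0; apply: contraNT ne => d0.
  have f1 : (t k - t l) * ((vertex R p.2).1 - (vertex R p.1).1) = 0.
    transitivity (((1 - t k) * (vertex R p.1).1 + t k * (vertex R p.2).1) -
      ((1 - t l) * (vertex R p.1).1 + t l * (vertex R p.2).1)); first by ring.
    by apply/eqP; rewrite subr_eq0; apply/eqP.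
  have f2 : (t k - t l) * ((vertex R p.2).2 - (vertex R p.1).2) = 0.
    transitivity (((1 - t k) * (vertex R p.1).2 + t k * (vertex R p.2).2) -
      ((1 - t l) * (vertex R p.1).2 + t l * (vertex R p.2).2)); first by ring.
    by apply/eqP; rewrite subr_eq0; apply/eqP.
  move/eqP: f1; move/eqP: f2; rewrite !mulf_eq0 (negPf d0) !orFb !subr_eq0 => /eqP g2 /eqP g1.
  by rewrite [vertex R p.1]surjective_pairing [vertex R p.2]surjective_pairing g1 g2.
have -> : [set: nat] = (fun k => @on_chord R n p (t k)) @^-1` (@chord R n p).
  by apply/seteqP; split => // k _; exists (t k).
by apply: finite_preimage fin => k l _ _; exact: inj.
Qed.

(** Otherwise the chord, an infinite set, would be covered by finitely many chords each
    meeting it in at most one point. *)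
Lemma chord_sub_shape (R : realType) n (D : {set 'I_n * 'I_n}) (p : 'I_n * 'I_n) :
  (2 < n)%N -> (p.1 < p.2)%N -> (forall q, q \in D -> (q.1 < q.2)%N) ->
  @chord R n p `<=` @shape R n D -> is_side p \/ p \in D.
Proof.
move=> n2 pp hD sub; apply: contrapT => /not_orP[ns /negP nD].
apply: (@chord_infinite R n p n2 pp).
pose Q := [set q : 'I_n * 'I_n | is_side q \/ q \in D].
apply: (@sub_finite_set _ _ (\bigcup_(q in Q) (@chord R n p `&` @chord R n q))).
  move=> z zp; case: (sub z zp) => -[q /= hq zq]; exists q => //; first by left.
  by right.
apply: bigcup_finite; first exact: finite_finset.
move=> q hq; have qq : (q.1 < q.2)%N by case: hq => [/andP[]|/hD].
have pq : p != q by apply/eqP => e; case: hq; rewrite -e // (negPf nD).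
exact: sub_finite_set (chords_meet_once pp qq pq) (finite_set1 _).
Qed.

Lemma noncrossing_sets_lt n (D : {set 'I_n * 'I_n}) : D \in noncrossing_sets n ->
  forall q, q \in D -> (q.1 < q.2)%N.
Proof. by move=> /noncrossing_setsP[h _] q /h /andP[]. Qed.

Lemma mem_shape (R : realType) n (D : {set 'I_n * 'I_n}) (p : 'I_n * 'I_n) :
  (2 < n)%N -> D \in noncrossing_sets n -> is_diagonal p ->
  (p \in D) = `[< @chord R n p `<=` @shape R n D >].
Proof.
move=> n2 Dnc dp; apply/idP/asboolP => [pD z zp|]; first by right; exists p.
case/(chord_sub_shape n2 _ (noncrossing_sets_lt Dnc)) => //; first by case/andP: dp.
by move=> sp; case/andP: dp => _; rewrite sp.
Qed.

Lemma shape_inj (R : realType) n : (2 < n)%N ->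
  {in noncrossing_sets n &, injective (@shape R n)}.
Proof.
move=> n2 D D' Dnc Dnc' e; apply/setP => p.
have [dp|dp] := boolP (is_diagonal p); first by rewrite !(@mem_shape R) // e.
have off E : E \in noncrossing_sets n -> p \in E = false.
  by case/noncrossing_setsP => h _; apply: contraNF dp; exact: h.
by rewrite !off.
Qed.

Lemma dissectionsE (R : realType) n : (2 < n)%N ->
  @dissections R n = @shape R n @` [set D | D \in noncrossing_sets n].
Proof.
move=> n2; apply/seteqP; split => S.
- case=> D [h1 h2 ->]; exists D => //=; apply/noncrossing_setsP; split => // p q pD qD.
  have [->|pq] := eqVneq p q; first by rewrite /cross ltnn.
  exact: (crossing_chords n2 (h2 _ _ pD qD pq)).
- case=> D /= Dnc <-; have /noncrossing_setsP[h1 h2] := Dnc; exists D; split => // p q pD qD pq.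
  have lt := noncrossing_sets_lt Dnc.
  by apply: noncrossing_chords; rewrite ?lt // h2.
Qed.

Lemma card_dissections (R : realType) n (E : set (set (plane R))) : (2 < n)%N ->
  #|` fset_set (@dissections R n `&` E)| =
  #|[set D in noncrossing_sets n | `[< E (@shape R n D) >]]%SET|.
Proof.
move=> n2; set A := (X in #|X|).
have inA D : (D \in A) = (D \in noncrossing_sets n) && `[< E (@shape R n D) >] by rewrite inE.
have fin : finite_set (@dissections R n `&` E).
  by apply: sub_finite_set (@finite_dissections R n); exact: subIsetl.
rewrite [RHS]cardE -(size_map (@shape R n)); apply: perm_size; apply: uniq_perm.
- exact: fset_uniq.
- rewrite map_inj_in_uniq ?enum_uniq // => D D'; rewrite !mem_enum.
  by rewrite !inA => /andP[Dnc _] /andP[Dnc' _]; exact: shape_inj.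
move=> S; rewrite [LHS]in_fset_set //; apply/idP/mapP => [|[D + ->]].
  rewrite inE dissectionsE // => -[[D /= Dnc <-] ED]; exists D => //.
  by rewrite mem_enum inA Dnc; apply/asboolP.
rewrite mem_enum inA => /andP[Dnc /asboolP ED]; rewrite inE; split => //.
by rewrite dissectionsE //; exists D.
Qed.

(** Only four pairs can code a side at [k]. *)
Lemma degree_shape (R : realType) n (D : {set 'I_n * 'I_n}) (k : 'I_n) :
  (2 < n)%N -> D \in noncrossing_sets n ->
  (diagonal_degree D k <= degree (@shape R n D) k <= diagonal_degree D k + 4)%N.
Proof.
move=> n2 Dnc; have lt := noncrossing_sets_lt Dnc; have /noncrossing_setsP[h1 h2] := Dnc.
apply/andP; split.
  apply: subset_leq_card; apply/fintype.subsetP => p; rewrite !inE => /andP[pD pk].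
  rewrite (h1 _ pD) orbT /=; apply/andP; split; apply/asboolP.
    by move=> z zp; right; exists p.
  by case/orP: pk => /eqP <-; [exact: chord_end1|exact: chord_end2].
pose I := [set p in D | (p.1 == k) || (p.2 == k)]%SET.
pose sides := [set (k, ordS k); (ordS k, k); (k, ord_pred k); (ord_pred k, k)]%SET.
have s4 : (#|sides| <= 4)%N.
  by rewrite /sides !cardsU !cards1; lia.
apply: leq_trans (leq_add (leqnn _) s4); rewrite -/I.
apply: leq_trans (leq_card_setU I sides); apply: subset_leq_card; apply/fintype.subsetP => p.
rewrite inE => /andP[/andP[sd /asboolP sub] /asboolP ck].
have pp : (p.1 < p.2)%N by case/orP: sd => /andP[].
have inc := chord_vertex pp ck; rewrite finset.in_setU; apply/orP.
case: (chord_sub_shape n2 pp lt sub) => [/andP[_ sp]|pD].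
  right; case: p inc sp {sd sub ck pp} => i j /= [<-|<-] /orP[/eqP e|/eqP e];
    by rewrite !inE !xpair_eqE e ?ordSK !eqxx ?orbT.
by left; rewrite inE pD; case: inc => ->; rewrite eqxx ?orbT.
Qed.

(** * Probabilities of large and of small degrees *)

Lemma card_noncrossing_ge (R : rcfType) n : (65 <= n)%N ->
  silver R ^+ (n.-1 + n.-1) <=
  384 * (n.-1%:R * Num.sqrt n.-1%:R * #|noncrossing_sets n|%:R).
Proof.
move=> n65; have n64 : (64 <= n.-1)%N by lia.
have h := @size_trees_ge R n.-1.*2 n.-1 n64 (leqnn _); apply: le_trans h _.
have := @size_trees_le n (ltac:(lia)); rewrite size_map -(ler_nat R) natrM => h.
rewrite [leRHS](_ : _ = 192 * (n.-1%:R * Num.sqrt n.-1%:R * (2 * #|noncrossing_sets n|%:R)));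
  last by ring.
by rewrite ler_wpM2l // ler_wpM2l // mulr_ge0 ?sqrtr_ge0.
Qed.

Lemma card_exists_le (T I : finType) (A : {set T}) (P : I -> pred T) c :
  (forall i, #|[set x in A | P i x]%SET| <= c)%N ->
  (#|[set x in A | [exists i, P i x]]%SET| <= #|I| * c)%N.
Proof.
move=> h; apply: (@leq_trans (\sum_(i : I) #|[set x in A | P i x]%SET|)%N); last first.
  by rewrite -sum_nat_const; exact: leq_sum.
under eq_bigr => i _ do rewrite -sum1_card big_mkcond.
rewrite exchange_big -sum1_card big_mkcond /=; apply: leq_sum => x _.
rewrite inE; case: ifP => // /andP[xA /existsP[i Pi]].
by rewrite (bigD1 i) //= inE xA Pi.
Qed.

(** The union bound over all vertices. *)
Lemma large_degree_le (R : rcfType) n k : (65 <= n)%N -> (k.+2 <= n.-1)%N ->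
  (#|[set D in noncrossing_sets n | [exists v, k <= diagonal_degree D v]%N]%SET|)%:R *
    silver R ^+ k.+1 <= (8 * 384) * n%:R * k.+1%:R * #|noncrossing_sets n|%:R.
Proof.
move=> n65 kn; pose N := n.-1; set c := #|noncrossing_sets n|%:R; set bad := _%:R.
pose f := size (forests N.*2 k.+1 N).
have b0 := silver_gt0 R.
have hbad : bad <= n%:R * f%:R.
  rewrite -natrM ler_nat.
  have := @card_exists_le _ 'I_n (noncrossing_sets n) (fun v D => k <= diagonal_degree D v)%N f.
  by rewrite card_ord; apply => v; apply: card_degree_le; lia.
have low := card_noncrossing_ge R n65; rewrite -/N -/c in low.
have [r rE] : exists r, N = (r + k.+2)%N by exists (N - k.+2)%N; rewrite /N; lia.
have up := @size_forests_le R N.*2 r k N rE (leqnn _); rewrite -/f in up.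
have N0 : 0 < N%:R * Num.sqrt N%:R :> R.
  by rewrite mulr_gt0 ?sqrtr_gt0 ?ltr0n // /N; lia.
set w := N%:R * Num.sqrt N%:R in N0 low up.
rewrite -(ler_pM2l N0).
have c0 : 0 <= c by [].
have bn : 0 <= silver R ^+ k.+1 by rewrite exprn_ge0 // ltW.
apply: (@le_trans _ _ (n%:R * (w * f%:R) * silver R ^+ k.+1)).
  rewrite (_ : n%:R * _ * _ = w * (n%:R * f%:R * silver R ^+ k.+1)); last by ring.
  by apply: ler_wpM2l; [exact: ltW|exact: ler_wpM2r].
apply: (@le_trans _ _ (n%:R * (8 * k.+1%:R * silver R ^+ (r.+1 + N)) * silver R ^+ k.+1)).
  by apply: ler_wpM2r => //; apply: ler_wpM2l.
rewrite (_ : _ * silver R ^+ k.+1 = n%:R * (8 * k.+1%:R) * silver R ^+ (N + N)); last first.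
  rewrite (_ : (N + N = (r.+1 + N) + k.+1)%N) ?exprD; [ring|lia].
apply: (@le_trans _ _ (n%:R * (8 * k.+1%:R) * (384 * (w * c)))).
  by apply: ler_wpM2l => //; rewrite !mulr_ge0.
by rewrite le_eqVlt; apply/orP; left; apply/eqP; ring.
Qed.

Lemma small_degrees_le (R : rcfType) n m : (65 <= n)%N -> (0 < m < n.-1)%N ->
  (#|[set D in noncrossing_sets n | [forall v, diagonal_degree D v < m]%N]%SET|)%:R *
    (n.-1%:R * m.+1%:R) <= (384 * 384) * silver R ^+ (m + 4) * #|noncrossing_sets n|%:R.
Proof.
move=> n65 /andP[m0 mn]; pose N := n.-1; set c := #|noncrossing_sets n|%:R; set bad := _%:R.
pose s := [seq t <- trees N | ~~ fan_seen m true (code t)].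
have b0 := silver_gt0 R.
have hbad : bad <= (size s)%:R by rewrite ler_nat; apply: card_sparse_le; lia.
have low := card_noncrossing_ge R n65; rewrite -/N -/c in low.
have us : uniq s by rewrite filter_uniq // trees_uniq.
have hs : {in s, forall t, weight t = N /\ ~~ fan_seen m true (code t)}.
  by move=> t; rewrite mem_filter mem_trees => /andP[? /eqP].
have := @avoiding_trees_le R N m s (ltac:(rewrite /N; lia)) mn us hs.
have N0 : 0 < N%:R * Num.sqrt N%:R :> R.
  by rewrite mulr_gt0 ?sqrtr_gt0 ?ltr0n // /N; lia.
set w := N%:R * Num.sqrt N%:R in N0 low *; set q := N%:R * m.+1%:R => up.
have q0 : 0 <= q by rewrite mulr_ge0.
have b4 : 0 <= silver R ^+ (m + 4) by rewrite exprn_ge0 // ltW.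
rewrite -(ler_pM2l N0).
apply: (@le_trans _ _ (w * (size s)%:R * q)).
  by rewrite -mulrA; apply: ler_wpM2l; [exact: ltW|exact: ler_wpM2r].
apply: le_trans up _.
apply: (@le_trans _ _ (384 * (384 * (w * c)) * silver R ^+ (m + 4))).
  by apply: ler_wpM2r; [exact: b4|apply: ler_wpM2l; [exact: ler0n|exact: low]].
by rewrite le_eqVlt; apply/orP; left; apply/eqP; ring.
Qed.

Lemma dissection_probE (R : realType) n (E : set (set (plane R))) : (2 < n)%N ->
  dissection_prob n E =
  (#|[set D in noncrossing_sets n | `[< E (@shape R n D) >]]%SET|)%:R /
  (#|noncrossing_sets n|)%:R.
Proof.
move=> n2; rewrite /dissection_prob card_dissections //; congr (_ / _%:R).
rewrite -[dissections n]setIT card_dissections //; apply: eq_card => D.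
by rewrite inE asboolT ?andbT.
Qed.

Lemma max_degree_shape (R : realType) n (D : {set 'I_n * 'I_n}) : (2 < n)%N ->
  D \in noncrossing_sets n ->
  (exists v, max_degree n (@shape R n D) <= diagonal_degree D v + 4)%N /\
  (forall v, diagonal_degree D v <= max_degree n (@shape R n D))%N.
Proof.
move=> n2 Dnc; have deg := fun k => degree_shape R k n2 Dnc; split.
  have [v ->] : exists v : 'I_n, max_degree n (@shape R n D) = degree (@shape R n D) v.
    have n0 : (0 < #|'I_n|)%N by rewrite card_ord; lia.
    by have [v hv] := @bigop.eq_bigmax _ (fun k : 'I_n => degree (@shape R n D) k) n0; exists v.
  by exists v; case/andP: (deg v).
move=> v; case/andP: (deg v) => h _; apply: leq_trans h _.
exact: (@bigop.leq_bigmax _ (fun k : 'I_n => degree (@shape R n D) k) v).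
Qed.

(** * Logarithms to the base b *)

Lemma ln_le_sub1 (R : realType) (x : R) : 0 < x -> ln x <= x - 1.
Proof.
move=> x0; have := @le_ln1Dx R (x - 1); rewrite [1 + (x - 1)]addrC subrK; apply.
by rewrite ltrBrDr addrC subrr.
Qed.

Lemma ln_silver_bounds (R : realType) : (1 / 2 : R) <= ln (silver R) <= 3 / 2.
Proof.
have /andP[b1 b2] := silver_bounds R; have b0 := silver_gt0 R.
have i0 : 0 < (silver R)^-1 by rewrite invr_gt0.
have i1 : (silver R)^-1 <= 1 / 2.
  rewrite div1r lef_pV2 ?posrE //; lra.
apply/andP; split.
  by have := ln_le_sub1 i0; rewrite lnV ?posrE //; lra.
by have := ln_le_sub1 b0; lra.
Qed.

Lemma log_silver_facts (R : realType) n : (200 <= n)%N ->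
  let L : R := log_base (silver R) n%:R in
  let L2 := log_base (silver R) L in
  [/\ 4 <= L, 0 <= L2, L2 <= L & 3 * L + 4 <= n%:R].
Proof.
move=> n200 L L2; have /andP[l1 l2] := ln_silver_bounds R.
have /andP[b1 b2] := silver_bounds R; have b0 := silver_gt0 R.
have nR : 200 <= n%:R :> R by rewrite ler_nat.
set lb := ln (silver R) in l1 l2; have lb0 : 0 < lb by lra.
have n0 : 0 < n%:R :> R by lra.
have L4 : 4 <= L.
  rewrite /L /log_base ler_pdivlMr // mulr_natl -lnXn // ler_ln ?posrE ?exprn_gt0 //.
  apply: le_trans nR; rewrite !exprS expr0.
  have bb : silver R * silver R <= 13 / 2 by nra.
  have bb0 : 0 <= silver R * silver R by rewrite mulr_ge0 // ltW.
  by rewrite mulr1 mulrA; clear -bb bb0; nra.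
have L0 : 0 < L by lra.
split => //.
- by rewrite /L2 /log_base divr_ge0 ?ln_ge0 //; lra.
- rewrite /L2 /log_base ler_pdivrMr //.
  have : ln L <= L / 2.
    have e : L = 2 * (L / 2) by rewrite mulrC divfK.
    have h2 : 0 < L / 2 by rewrite divr_gt0.
    rewrite {1}e lnM ?posrE //.
    have := @ln_le_sub1 R 2 (ltr0n _ _); have := ln_le_sub1 h2; lra.
  move=> h; apply: le_trans h _; apply: ler_wpM2l; first exact: ltW.
  by rewrite -div1r.
- set w := Num.sqrt (n%:R : R).
  have w0 : 0 < w by rewrite sqrtr_gt0.
  have w2 : w * w = n%:R by rewrite -expr2 sqr_sqrtr // ltW.
  have w14 : 14 <= w by nra.
  have lw : ln (n%:R : R) <= 2 * w.
    rewrite -w2 lnM ?posrE //; have := ln_sublinear w0; lra.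
  have : L <= 4 * w.
    rewrite /L /log_base ler_pdivrMr //; apply: le_trans lw _.
    have := mulr_ge0 (ltW w0) (_ : 0 <= lb - 1 / 2); rewrite subr_ge0 => /(_ l1); rewrite -/lb;
      clear; lra.
  have := sqr_ge0 (w - 14); clear -w2 w14; nra.
Qed.

Lemma silver_exp (R : realType) k : silver R ^+ k = expR (k%:R * ln (silver R)).
Proof. by rewrite expRM_natl lnK // posrE silver_gt0. Qed.

Lemma log_silverK (R : realType) (x : R) : 0 < x ->
  expR (log_base (silver R) x * ln (silver R)) = x.
Proof.
move=> x0; have /andP[l1 _] := ln_silver_bounds R.
by rewrite /log_base divfK ?gt_eqF ?lnK ?posrE //; lra.
Qed.

Lemma between_consecutive_nats (R : realType) (x : R) : 0 <= x -> exists k, k%:R <= x < k.+1%:R.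
Proof. by move=> x0; exists (Num.truncn x); exact: truncn_itv. Qed.

(** The threshold [k] is 4 below lambda + w because of the four units by which [degree] may exceed
    [diagonal_degree]. Since b^(L + L2) = n L, the factor b^-(k + 1) compensates n (k + 1). *)
Lemma upper_threshold (R : realType) n k (w : R) : (200 <= n)%N ->
  let L : R := log_base (silver R) n%:R in
  let L2 := log_base (silver R) L in
  0 <= w <= L2 -> k%:R <= L + L2 + w - 4 < k.+1%:R ->
  (k.+2 <= n.-1)%N /\
  n%:R * k.+1%:R <= 3 * silver R ^+ 4 * expR (- (w * ln (silver R))) * silver R ^+ k.+1.
Proof.
move=> n200 L L2 /andP[w0 wL] /andP[k1 k2].
have [L4 L20 LL nL] := @log_silver_facts R n n200; rewrite -/L -/L2 in L4 L20 LL nL.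
have /andP[l1 _] := ln_silver_bounds R.
have n0 : 0 < n%:R :> R by rewrite ltr0n; lia.
split.
  have : k%:R + 4 <= n%:R :> R by lra.
  by rewrite -natrD ler_nat; clear; lia.
rewrite !silver_exp; set lb := ln (silver R) in l1 *.
have kL : k.+1%:R <= 3 * L by rewrite -natr1; lra.
have nL2 : n%:R * L = expR (L * lb) * expR (L2 * lb).
  by rewrite !log_silverK //; lra.
clearbody L2; clearbody L.
apply: (@le_trans _ _ (n%:R * (3 * L))); first by rewrite ler_wpM2l // ltW.
rewrite mulrCA nL2 -!mulrA ler_pM2l // -!expRD ler_expR.
have : (L + L2 + w - 4) * lb <= k.+1%:R * lb.
  by apply: ler_wpM2r; [lra|exact: ltW].
clear; lra.
Qed.

(** Here b^(L + L2) = n L, while [m + 2] is at least [L] because [w] is at most [L2]. *)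
Lemma lower_threshold (R : realType) n m (w : R) : (200 <= n)%N ->
  let L : R := log_base (silver R) n%:R in
  let L2 := log_base (silver R) L in
  0 <= w <= L2 -> m%:R <= L + L2 - w < m.+1%:R ->
  (0 < m.+1 < n.-1)%N /\
  silver R ^+ (m.+1 + 4) <=
    2 * silver R ^+ 5 * expR (- (w * ln (silver R))) * (n.-1%:R * m.+2%:R).
Proof.
move=> n200 L L2 /andP[w0 wL] /andP[m1 m2].
have [L4 L20 LL nL] := @log_silver_facts R n n200; rewrite -/L -/L2 in L4 L20 LL nL.
have /andP[l1 _] := ln_silver_bounds R.
have n0 : 0 < n%:R :> R by rewrite ltr0n; lia.
split.
  have : m%:R + 4 <= n%:R :> R by lra.
  by rewrite -natrD ler_nat; clear; lia.
have nL2 : n%:R * L = expR (L * ln (silver R)) * expR (L2 * ln (silver R)).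
  by rewrite !log_silverK //; lra.
clearbody L2; clearbody L.
have mL : L <= m.+2%:R.
  apply: (@le_trans _ _ m.+1%:R); last by rewrite ler_nat.
  by apply: ltW; apply: le_lt_trans m2; rewrite -addrA lerDl subr_ge0.
have nn : n%:R <= 2 * n.-1%:R :> R by rewrite -natrM ler_nat; clear -n200; lia.
apply: (@le_trans _ _ (silver R ^+ 5 * expR (- (w * ln (silver R))) * (n%:R * L))).
  rewrite nL2 !silver_exp; set lb := ln (silver R) in l1 *.
  rewrite -!expRD ler_expR.
  have : m%:R * lb <= (L + L2 - w) * lb by apply: ler_wpM2r => //; lra.
  by rewrite natrD -natr1; clear; lra.
set E := expR (- _); set P := silver R ^+ 5.
have -> : 2 * P * E * (n.-1%:R * m.+2%:R) = P * E * (2 * n.-1%:R * m.+2%:R) by ring.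
apply: ler_wpM2l; first by rewrite mulr_ge0 ?expR_ge0 // exprn_ge0 // ltW // silver_gt0.
by apply: ler_pM => //; lra.
Qed.

(** * The deviation bound *)

Lemma deviation_prob_le (R : realType) (n : nat) (w : R) : (200 <= n)%N ->
  let lb := log_base (silver R) in
  0 <= w <= lb (lb n%:R) ->
  @dissection_prob R n
     [set S | w <= `|(max_degree n S)%:R - (lb n%:R + lb (lb n%:R))|] <=
  (8 * 384 * (3 * silver R ^+ 4) + 384 * 384 * (2 * silver R ^+ 5)) *
  expR (- (w * ln (silver R))).
Proof.
move=> n200 lb w01; have n2 : (2 < n)%N by lia.
have n65 : (65 <= n)%N by lia.
have [L4 L20 LL _] := @log_silver_facts R n n200; rewrite -/lb in L4 L20 LL.
have x0 : 0 <= lb n%:R + lb (lb n%:R) + w - 4.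
  by case/andP: w01 => w0 _; clear -L4 L20 w0; lra.
have [k kx] := between_consecutive_nats x0.
have y0 : 0 <= lb n%:R + lb (lb n%:R) - w.
  by case/andP: w01 => _ w1; clear -L4 w1; lra.
have [m mx] := between_consecutive_nats y0.
have [kn upper] := @upper_threshold R n k w n200 w01 kx.
have [mn lower] := @lower_threshold R n m w n200 w01 mx.
have b0 := silver_gt0 R.
pose nc := noncrossing_sets n; pose c : R := #|nc|%:R.
pose A1 := [set D in nc | [exists v, k <= diagonal_degree D v]%N]%SET.
pose A2 := [set D in nc | [forall v, diagonal_degree D v < m.+1]%N]%SET.
set E := expR _ in upper lower *; have E0 : 0 < E := expR_gt0 _.
have c0 : 0 < c.
  rewrite ltr0n card_gt0; apply/finset.set0Pn; exists finset.set0.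
  by apply/noncrossing_setsP; split => [p|p q]; rewrite finset.in_set0.
have h1 : #|A1|%:R <= 8 * 384 * (3 * silver R ^+ 4) * E * c.
  have bk : 0 < silver R ^+ k.+1 by rewrite exprn_gt0.
  rewrite -(ler_pM2r bk); apply: le_trans (large_degree_le R n65 kn) _; rewrite -/c.
  rewrite (_ : _ * c = 8 * 384 * c * (n%:R * k.+1%:R)); last by ring.
  rewrite (_ : _ * silver R ^+ k.+1 = 8 * 384 * c * (3 * silver R ^+ 4 * E * silver R ^+
    k.+1)); last by ring.
  by apply: ler_wpM2l upper; rewrite mulr_ge0 ?mulr_ge0 ?ler0n // ltW.
have h2 : #|A2|%:R <= 384 * 384 * (2 * silver R ^+ 5) * E * c.
  have q0 : 0 < n.-1%:R * m.+2%:R :> R by apply: mulr_gt0; rewrite ltr0n //; clear -n200; lia.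
  rewrite -(ler_pM2r q0); apply: le_trans (small_degrees_le R n65 mn) _; rewrite -/c.
  rewrite (_ : _ * c = 384 * 384 * c * silver R ^+ (m.+1 + 4)); last by ring.
  rewrite (_ : _ * (n.-1%:R * m.+2%:R) =
    384 * 384 * c * (2 * silver R ^+ 5 * E * (n.-1%:R * m.+2%:R))); last by ring.
  by apply: ler_wpM2l lower; rewrite mulr_ge0 ?mulr_ge0 ?ler0n // ltW.
rewrite dissection_probE // -/nc -/c ler_pdivrMr //.
set A := (X in #|X|).
apply: (@le_trans _ _ (#|A1|%:R + #|A2|%:R)); last first.
  by apply: le_trans (lerD h1 h2) _; rewrite -!mulrDl.
rewrite -natrD ler_nat; apply: leq_trans (leq_card_setU A1 A2).
apply: subset_leq_card; apply/fintype.subsetP => D.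
rewrite inE => /andP[Dnc /asboolP /=].
have [[v hv] lo] := @max_degree_shape R n D n2 Dnc.
have iA1 : (D \in A1) = [exists v, k <= diagonal_degree D v]%N by rewrite inE Dnc.
have iA2 : (D \in A2) = [forall v, diagonal_degree D v < m.+1]%N by rewrite inE Dnc.
rewrite finset.in_setU iA1 iA2; set Delta := max_degree _ _ in hv lo *.
case/andP: kx => k1 _; case/andP: mx => _ m2.
have [ge|lt] := lerP (lb n%:R + lb (lb n%:R)) Delta%:R => dev.
  apply/orP; left; apply/existsP; exists v; rewrite -(ler_nat R).
  have : Delta%:R <= (diagonal_degree D v)%:R + 4 :> R by rewrite -natrD ler_nat.
  by clear -k1 dev; lra.
apply/orP; right; apply/forallP => u; rewrite -(ltr_nat R).
have : (diagonal_degree D u)%:R <= Delta%:R :> R by rewrite ler_nat.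
by clear -m2 dev; lra.
Qed.

Lemma deviation_prob_bound (R : realType) : exists2 K : R, 0 < K &
  forall (n : nat) (w : R), (200 <= n)%N ->
  let lb := log_base (silver R) in
  0 <= w <= lb (lb n%:R) ->
  @dissection_prob R n
     [set S | w <= `|(max_degree n S)%:R - (lb n%:R + lb (lb n%:R))|] <=
  K * expR (- (w * ln (silver R))).
Proof.
exists (8 * 384 * (3 * silver R ^+ 4) + 384 * 384 * (2 * silver R ^+ 5)); last first.
  by move=> n w n200 lb w01; exact: deviation_prob_le.
have b0 := silver_gt0 R.
by apply: addr_gt0; apply: mulr_gt0; apply: mulr_gt0; rewrite ?ltr0n // exprn_gt0.
Qed.

Theorem theorem1 (R : realType) (Omega : nat -> R)
    (Omega_infty : Omega n @[n --> \oo] --> +oo) :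
  let b : R := 1 + Num.sqrt 2 in
  let lambda (n : nat) : R :=
    log_base b n%:R + log_base b (log_base b n%:R) in
  (fun n : nat => @dissection_prob R n
     [set S : set (plane R) |
        Omega n <= `|(max_degree n S)%:R - lambda n|] : R^o)
  =O_\oo
  (fun n : nat => (ln n%:R)^-1 + b `^ (- Omega n) : R^o).
Proof.
move=> b lambda; rewrite -[b]/(silver R) in lambda *.
have b0 := silver_gt0 R; have /andP[l1 l2] := ln_silver_bounds R.
have [K K0 dev] := deviation_prob_bound R.
apply/eqO_exP; exists (K * (3 / 2)); first by rewrite mulr_gt0.
have Om0 : \forall n \near \oo, 0 <= Omega n by move/cvgryPge: Omega_infty; apply.
near=> n.
have n200 : (200 <= n)%N by near: n; exact: nbhs_infty_ge.
have On : 0 <= Omega n by near: n.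
have [L4 L20 LL _] := @log_silver_facts R n n200.
set L := log_base _ n%:R in L4 L20 LL; set L2 := log_base _ L in L20 LL.
have ln0 : 0 < ln (n%:R : R) by rewrite ln_gt0 // ltr1n; clear -n200; lia.
have p0 : 0 < silver R `^ (- Omega n) := powR_gt0 _ b0.
have i0 : 0 < (ln (n%:R : R))^-1 by rewrite invr_gt0.
(* At w = log_b log_b n the bound b^-w is already of the order of 1 / ln n. *)
pose w := Order.min (Omega n) L2.
have w01 : 0 <= w <= L2 by rewrite /w le_min On L20 ge_min lexx orbT.
have sub : dissection_prob n [set S : set (plane R) | Omega n <= `|(max_degree n S)%:R - lambda
  n|] <=
   dissection_prob n [set S : set (plane R) | w <= `|(max_degree n S)%:R - (L + L2)|].
  have n2 : (2 < n)%N by clear -n200; lia.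
  rewrite !dissection_probE // ler_wpM2r ?invr_ge0 // ler_nat; apply: subset_leq_card.
  apply/fintype.subsetP => D; rewrite inE => /andP[Dnc /asboolP /= h]; rewrite inE Dnc;
    apply/asboolP => /=.
  by apply: le_trans h; rewrite /w ge_min lexx.
have prob0 : 0 <= dissection_prob n [set S : set (plane R) | Omega n <= `|(max_degree n S)%:R -
  lambda n|].
  by rewrite /dissection_prob divr_ge0.
rewrite [X in X <= _]ger0_norm // ger0_norm; last by rewrite addr_ge0 // ltW.
apply: le_trans sub _; apply: le_trans (dev n w n200 w01) _.
rewrite -mulrA ler_pM2l //.
rewrite /w; case: (leP (Omega n) L2) => _.
  have -> : expR (- (Omega n * ln (silver R))) = silver R `^ (- Omega n).
    by rewrite /powR gt_eqF // mulNr.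
  by clear -p0 i0; lra.
have -> : expR (- (L2 * ln (silver R))) = ln (silver R) * (ln n%:R)^-1.
  by rewrite expRN log_silverK ?invf_div //; clear -L4; lra.
apply: (@le_trans _ _ (3 / 2 * (ln n%:R)^-1)); first by rewrite ler_wpM2r // ltW.
by clear -p0 i0; lra.
Unshelve. all: by end_near.
Qed.
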